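(* Let $X$ be the product of $q\geq 3$ projective spaces $X=\mathbb{P}^{a_1}\times\cdots\times\mathbb{P}^{a_q}$. If $$k\leq \frac{\prod_{i=1}^{q}(a_i+1)-(a_1+a_2+a_3+1)\prod_{i=3}^{q}(a_i+1)}{1+\sum_{i=1}^{q}a_i},$$ then the dimension of the $k$-secant variety $S_k(X)$ is the expected one, namely it is equal to $k\left(1+\sum_{i=1}^q a_i\right)-1$.
   Context: All varieties are over $\mathbb{C}$. The product $X$ is regarded as a Segre variety, naturally embedded in $\mathbb{P}^N$ with $N=-1+\prod_{i=1}^q(a_i+1)$. For an irreducible projective variety $X\subset\mathbb{P}^N$, the $k$-th secant variety $S_k(X)$ is the Zariski closure of $\bigcup_{x_1,\ldots,x_k\in X}\langle x_1,\ldots,x_k\rangle$; here $k$ is a positive integer.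
   Formalization: The formal theorem additionally assumes a_1 ≤ a_3 and a_2 ≤ a_3; without an ordering of the factors the claim fails, e.g. for (a_1,a_2,a_3) = (100,3,3) and k = 11, where the dimension is at most 1165 rather than 1176. *)

(* Defs.v *)
From mathcomp Require Import all_boot all_order all_algebra.
From mathcomp Require Import mpoly.
From mathcomp Require Import classical_sets reals complex.

Set Implicit Arguments.
Unset Strict Implicit.
Unset Printing Implicit Defensive.

Import GRing.Theory.
Local Open Scope ring_scope.
Local Open Scope classical_set_scope.

(* [proj C n] is the set of lines through the origin of C^n, that is, the
   projective space of dimension n - 1. *)
Definition proj (C : fieldType) (n : nat) : Type :=
  {L : {vspace 'rV[C]_n} | \dim L == 1%N}.

Section Zariski.
Variables (C : fieldType) (n : nat).
Implicit Types (L : proj C n) (A Y Z : set (proj C n)).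

Definition vanishes_at (p : {mpoly C[n]}) L : Prop :=
  forall v : 'rV[C]_n, v \in val L -> p.@[fun i => v 0 i] = 0.

Definition zariski_closed Z : Prop :=
  exists S : set {mpoly C[n]},
    (forall p, S p -> exists d : nat, p \is d.-homog) /\
    Z = [set L | forall p, S p -> vanishes_at p L].

Definition zariski_closure A : set (proj C n) :=
  [set L | forall Z, zariski_closed Z -> A `<=` Z -> Z L].

Definition irreducible Z : Prop :=
  Z !=set0 /\
  forall Z1 Z2, zariski_closed Z1 -> zariski_closed Z2 ->
    Z `<=` Z1 `|` Z2 -> Z `<=` Z1 \/ Z `<=` Z2.

(* Z_0 < Z_1 < ... < Z_d; the values c i for i > d are irrelevant. *)
Definition irreducible_chain Y (d : nat) (c : nat -> set (proj C n)) : Prop :=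
  (forall i, (i <= d)%N ->
     [/\ zariski_closed (c i), irreducible (c i) & c i `<=` Y]) /\
  (forall i, (i < d)%N -> c i `<` c i.+1).

(* Krull dimension of a Zariski closed set Y. *)
Definition has_dimension Y (d : nat) : Prop :=
  (exists c, irreducible_chain Y d c) /\
  (forall e c, irreducible_chain Y e c -> (e <= d)%N).

Definition secant_variety (X : set (proj C n)) (k : nat) : set (proj C n) :=
  zariski_closure
    [set L | exists x : 'I_k -> proj C n,
       (forall j, X (x j)) /\ (val L <= \sum_j val (x j))%VS].

End Zariski.

Section Segre.
Variables (C : fieldType) (q : nat) (a : 'I_q -> nat).

Definition multi_index : finType := {dffun forall i : 'I_q, 'I_(a i).+1}.

Lemma card_multi_index : #|multi_index| = (\prod_(i < q) (a i).+1)%N.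
Proof.
rewrite card_dep_ffun foldrE big_map big_enum /=.
by apply: eq_bigr => i _; rewrite card_ord.
Qed.

(* The coordinates of the ambient space are indexed by [multi_index] through
   its enumeration; the order chosen is immaterial. *)
Definition segre_vector (v : forall i : 'I_q, 'rV[C]_(a i).+1) :
  'rV[C]_#|multi_index| :=
  \row_j \prod_(i < q) v i 0 ((enum_val j : multi_index) i).

(* The image of P^(a_1) x ... x P^(a_q); v gives homogeneous coordinates of the
   q components of a point of the product. *)
Definition segre_variety : set (proj C #|multi_index|) :=
  [set L | exists v : forall i : 'I_q, 'rV[C]_(a i).+1,
     (forall i, v i != 0) /\ val L = <[segre_vector v]>%VS].

End Segre.

Arguments segre_variety C {q} a.

(* Main.v *)
Require Import Defs.
From mathcomp Require Import all_boot all_order all_algebra.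
From mathcomp Require Import reals complex.
From mathcomp Require Import mpoly zify ring.
From mathcomp Require Import boolp classical_sets.

(** Why the theorem is true.

  Write n_i = a_i + 1, let V = V_1 (x) ... (x) V_q be the tensor space, and call
  D_q = 1 + sum a_i the affine dimension of the Segre cone.  By Terracini's
  principle it is enough to exhibit k decomposable tensors whose tangent spaces,
  each of dimension D_q, are in direct sum inside V.  The file has two
  independent halves: the construction of such points, and the passage from
  them to the Krull dimension of the secant variety.

  Construction of the points.  Since n_1 n_2 = (a_1 a_2 - a_3) + D_3, the bound on
  k says k D_q <= c M_q with c = a_1 a_2 - a_3 and M_q = n_3 ... n_q.  The basic
  move ([direct_split]) cuts the coordinates of the last factor V_q into blocks
  and puts the last component of each point inside one block.  A linear relation
  between tangent vectors then falls apart into one relation per block: in it the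
  points of that block contribute a tangent space, and every other point x only
  contributes x' (x) (block), where x' is x without its last component.  Being
  linearly independent is an open condition, so each block may use a
  configuration of its own ([open_common], [direct_split_generic]).

  With blocks of size 1 this is an induction on q ([nondefective_step]): a block
  sees about k / n_q tangent spaces with q - 1 factors and k further points, and
  general points impose independent conditions as long as there is room
  ([direct_add_points]).  The inequality (k - 1) D_q < c M_q is stable under
  this reduction, with room to spare ([nondefective_bound]).

  For q = 3 blocks of size 2 are used ([nondefective3]).  Two tangent spaces
  of a Segre variety of matrices always meet, but in a space of pencils
  V_1 (x) V_2 (x) C^2 the tangent spaces at e_i (x) e_i (x) (1, i), for i < s, are
  independent; and there are explicit rank one matrices y whose planes y (x) C^2
  are independent of these tangent spaces and of each other, and which fill the
  remaining space up to one dimension in each row and column beyond the first s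
  ([block_direct]).
  When n_3 is odd one block of size 1 is left over, which receives one point.
  The inequalities a_1, a_2 <= a_3 keep the number of points per block below
  n_1 and n_2 ([pencil_capacity]).

  Dimension theory.  Let Z_0 < ... < Z_e be a chain of irreducible closed sets.
  Homogeneous polynomials separating consecutive members, together with one
  coordinate function, are e + 1 algebraically independent functions on the cone
  over Z_e ([regular_sequence_indep]), while on the image of a polynomial map in M
  variables any M + 1 polynomials are algebraically dependent
  ([algebraic_relation]); so e < M ([chain_bound]).  The secant variety is the
  closure of the image of a chart with M = k D_q parameters ([chart_dense]).
  Conversely, if k tangent spaces are independent, then the closures of the
  images of a flag of parameter spaces through the chosen points form a chain of
  length k D_q - 1: consecutive members differ because, near the chosen
  point, the larger one has one more local coordinate ([param_chain]). *)

Set Implicit Arguments.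
Unset Strict Implicit.
Unset Printing Implicit Defensive.

Import Order.TTheory GRing.Theory Num.Theory.
Local Open Scope ring_scope.

(** * Restriction of polynomials to curves *)

Section UnivariatePolynomials.
Variable C : numFieldType.
Implicit Types (g u : {poly C}).

Lemma poly_nonroot g : g != 0 -> exists t, g.[t] != 0.
Proof.
move=> g0; pose rs : seq C := [seq i%:R | i <- iota 0 (size g)].
have Urs : uniq rs.
  by rewrite map_inj_uniq ?iota_uniq // => i j /eqP; rewrite eqr_nat => /eqP.
have /allPn[t _ rt] : ~~ all (root g) rs.
  apply/negP=> Hall; have := max_poly_roots g0 Hall Urs.
  by rewrite size_map size_iota ltnn.
by exists t.
Qed.

(** Identities between one-parameter families are checked below for almost all values
  of the parameter. *)
Lemma poly_eq0_off g u :
  g != 0 -> (forall t, g.[t] != 0 -> u.[t] = 0) -> u = 0.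
Proof.
move=> g0 Hu; apply/eqP/negPn/negP=> u0.
have [|t] := @poly_nonroot (g * u); first by rewrite mulf_neq0.
rewrite hornerM; have [->|gt] := eqVneq g.[t] 0; first by rewrite mul0r eqxx.
by rewrite (Hu t gt) mulr0 eqxx.
Qed.

End UnivariatePolynomials.

Section Restriction.
Variables (C : numFieldType) (n : nat).
Implicit Types (p : {mpoly C[n]}) (x y : 'I_n -> C) (w : 'I_n -> {poly C}).

Definition along p w : {poly C} := mmap (@polyC C) w p.

Lemma alongE p w t : (along p w).[t] = p.@[fun i => (w i).[t]].
Proof.
rewrite /along /mmap horner_sum mevalE; apply: eq_bigr => m _.
rewrite hornerM hornerC /mmap1 -horner_evalE rmorph_prod /=.
by congr (_ * _); apply: eq_bigr => i _; rewrite horner_evalE horner_exp.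
Qed.

Definition segment x y : 'I_n -> {poly C} := fun i => (x i)%:P + 'X * (y i)%:P.

Lemma segmentE x y i t : (segment x y i).[t] = x i + t * y i.
Proof. by rewrite /segment !hornerE. Qed.

Lemma homog_scale d p x t :
  p \is d.-homog -> p.@[fun i => t * x i] = t ^+ d * p.@[x].
Proof.
move=> /dhomogP Hp; rewrite !mevalE mulr_sumr; apply: eq_big_seq => m mp.
rewrite mulrCA; congr (_ * _).
have <- : mdeg m = d by apply: Hp.
rewrite mdegE -prodrXr -big_split /=.
by apply: eq_bigr => i _; rewrite exprMn.
Qed.

Lemma digits_inj B k (a b : nat -> nat) :
  (forall i, (i < k)%N -> (a i < B)%N) -> (forall i, (i < k)%N -> (b i < B)%N) ->
  (\sum_(i < k) a i * B ^ i = \sum_(i < k) b i * B ^ i)%N ->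
  forall i, (i < k)%N -> a i = b i.
Proof.
elim: k a b => // k IHk a b Ha Hb.
rewrite !big_ord_recl !expn0 !muln1 /=.
have shift (f : nat -> nat) : (\sum_(i < k) f (bump 0 i) * B ^ bump 0 i
    = (\sum_(i < k) f i.+1 * B ^ i) * B)%N.
  by rewrite big_distrl /=; apply: eq_bigr => i _; rewrite /bump /= add1n expnSr mulnA.
rewrite !shift => Hab.
have B0 : (0 < B)%N by apply: leq_ltn_trans (Ha 0%N isT).
have Hmod : (a 0 = b 0)%N.
  move: (congr1 (modn^~ B) Hab).
  by rewrite /= ![(_ + _ * B)%N]addnC !modnMDl !modn_small ?Ha ?Hb.
case=> [//|i] Hi; apply: (IHk (fun i => a i.+1) (fun i => b i.+1)) => //.
- by move=> j Hj; apply: Ha.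
- by move=> j Hj; apply: Hb.
by apply/eqP; rewrite -(eqn_pmul2r B0) -(eqn_add2l (a 0)) {2}Hmod Hab.
Qed.

(** Restriction to the curve (t, t^B, t^(B^2), ...) sends the monomials of
  small degree to distinct powers of t, so it kills no nonzero polynomial when
  B exceeds the degree. *)
Lemma mpoly_eq0_meval p : (forall x, p.@[x] = 0) -> p = 0.
Proof.
move=> Hp; apply/mpolyP => m; rewrite mcoeff0.
have [pm|] := boolP (m \in msupp p); last by rewrite -mcoeff_eq0 => /eqP.
pose B := msize p; pose wt (m : 'X_{1..n}) := (\sum_(i < n) m i * B ^ i)%N.
pose w (i : 'I_n) : {poly C} := 'X ^+ (B ^ i).
have Hw : along p w = \sum_(m <- msupp p) (p@_m)%:P * 'X^(wt m).
  apply: eq_bigr => k _; congr (_ * _).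
  by rewrite /mmap1 /wt -prodrXr; apply: eq_bigr => i _; rewrite -exprM mulnC.
have /polyP/(_ (wt m)) : along p w = 0.
  apply: (@poly_eq0_off _ 1); first exact: oner_neq0.
  by move=> t _; rewrite alongE Hp.
rewrite Hw coef0 coef_sum (bigD1_seq m) ?msupp_uniq //=.
rewrite coefCM coefXn eqxx mulr1 big_seq_cond big1 ?addr0 //.
move=> k /andP[pk kNm]; rewrite coefCM coefXn; case: eqP => [/esym Ekm|_];
  last by rewrite mulr0.
case/eqP: kNm; apply/mnmP => i.
pose dig (j : 'X_{1..n}) l := if insub l is Some o then j o else 0%N.
have digE j (l : 'I_n) : dig j l = j l by rewrite /dig valK.
have lt_dig j : j \in msupp p -> forall l, (l < n)%N -> (dig j l < B)%N.
  move=> pj l ln; rewrite (digE j (Ordinal ln)).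
  apply: leq_ltn_trans (msize_mdeg_lt pj).
  by rewrite mdegE (bigD1 (Ordinal ln)) //= leq_addr.
rewrite -!digE; apply: (digits_inj (lt_dig k pk) (lt_dig m pm) _ (ltn_ord i)).
rewrite (eq_bigr (fun l : 'I_n => k l * B ^ l)%N) => [|l _]; last by rewrite digE.
rewrite [RHS](eq_bigr (fun l : 'I_n => m l * B ^ l)%N) => [|l _]; last by rewrite digE.
exact: Ekm.
Qed.

Lemma coef_along_line p x d :
  (along p (fun i => 'X * (x i)%:P))`_d = (pihomog mdeg d p).@[x].
Proof.
rewrite /along /mmap coef_sum pihomogE raddf_sum [RHS]big_mkcond /=.
apply: eq_bigr => m _; rewrite coefCM.
have -> : mmap1 (fun i => 'X * (x i)%:P) m = (mmap1 x m)%:P * 'X^(mdeg m).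
  rewrite /mmap1 rmorph_prod mdegE -prodrXr -big_split /=.
  by apply: eq_bigr => i _; rewrite exprMn mulrC rmorphXn.
rewrite coefCM coefXn eq_sym; case: eqP => _; last by rewrite !mulr0.
by rewrite mevalZ mevalX mulr1.
Qed.

End Restriction.

(** * Vanishing ideals of projective sets *)

Section VanishingIdeals.
Variables (C : numFieldType) (n : nat).
Implicit Types (p g h : {mpoly C[n]}) (L : proj C n) (Y Z A : set (proj C n)).
Implicit Types v : 'rV[C]_n.
Local Open Scope classical_set_scope.

Definition vanishing Y p : Prop := forall L, Y L -> vanishes_at p L.

Lemma dim_line v : v != 0 -> \dim <[v]> == 1%N.
Proof. by rewrite dim_vline => ->. Qed.

Definition proj_point v (v0 : v != 0) : proj C n := exist _ <[v]>%VS (dim_line v0).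

Lemma proj_vline L : exists2 v, v != 0 & val L = <[v]>%VS.
Proof.
case: L => L /= dL; have L0 : L != 0%VS by rewrite -dimv_eq0 (eqP dL).
exists (vpick L); first by rewrite vpick0.
apply/esym/eqP; rewrite eqEdim (eqP dL) dim_vline vpick0 L0 andbT.
by rewrite -memvE memv_pick.
Qed.

Lemma vanishes_atP p L v : val L = <[v]>%VS ->
  (vanishes_at p L <-> forall t, p.@[fun i => t * v 0 i] = 0).
Proof.
move=> LE; split=> [H t|H w].
  have /H : t *: v \in val L by rewrite LE memvZ ?memv_line.
  by move=> <-; apply: meval_eq => i; rewrite mxE.
rewrite LE => /vlineP[t ->]; rewrite -(H t).
by apply: meval_eq => i; rewrite mxE.
Qed.

Lemma vanishes_at_homogP p d L v : p \is d.-homog -> val L = <[v]>%VS ->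
  p.@[fun i => v 0 i] = 0 -> vanishes_at p L.
Proof.
by move=> ph LE pv; apply/(vanishes_atP p LE) => t; rewrite (homog_scale _ _ ph) pv mulr0.
Qed.

Lemma along_scale p v t :
  (along p (fun i => 'X * (v 0 i)%:P)).[t] = p.@[fun i => t * v 0 i].
Proof. by rewrite alongE; apply: meval_eq => i; rewrite !hornerE. Qed.

Lemma vanishes_at_pihomog p L :
  vanishes_at p L <-> forall d, vanishes_at (pihomog mdeg d p) L.
Proof.
have [v _ LE] := proj_vline L; split=> [/(vanishes_atP p LE) H d|H].
  apply: (vanishes_at_homogP (pihomogP mdeg d p) LE).
  rewrite -coef_along_line.
  have -> : along p (fun i => 'X * (v 0 i)%:P) = 0; last by rewrite coef0.
  apply: (@poly_eq0_off _ 1); first exact: oner_neq0.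
  by move=> t _; rewrite along_scale.
move=> w wL; rewrite [p](pihomog_partitionE (mf := mdeg) (leqnn _)) raddf_sum big1 // => d _.
exact: H.
Qed.

(** A polynomial vanishes on a line through the origin exactly when all its
  homogeneous components do, so inhomogeneous equations define closed sets too. *)
Lemma closed_vanishes_at p : zariski_closed [set L | vanishes_at p L].
Proof.
exists [set h | exists d, h = pihomog mdeg d p]; split.
  by move=> _ [d ->]; exists d; apply: pihomogP.
rewrite predeqE => L /=; rewrite vanishes_at_pihomog.
by split=> [H _ [d ->]|H d]; [apply: H | apply: H; exists d].
Qed.

Lemma closure_min A Z : zariski_closed Z -> A `<=` Z -> zariski_closure A `<=` Z.
Proof. by move=> Zc AZ L; apply. Qed.

Lemma subset_closure A : A `<=` zariski_closure A.
Proof. by move=> L AL Z _; apply. Qed.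

Lemma closure_mono A B : A `<=` B -> zariski_closure A `<=` zariski_closure B.
Proof. by move=> AB L HL Z Zc BZ; apply: HL => // M /AB /BZ. Qed.

Lemma vanishing_closure A p : vanishing (zariski_closure A) p <-> vanishing A p.
Proof.
split=> [H L AL|H]; first exact: (H L (subset_closure AL)).
by apply: (closure_min (closed_vanishes_at p)).
Qed.

Lemma closed_closure A : zariski_closed (zariski_closure A).
Proof.
exists [set p | (exists d, p \is d.-homog) /\ vanishing A p]; split; first by move=> p [].
rewrite predeqE => L; split=> [HL p [_ pA]|HL Z [S [Sh ->]] AZ p Sp].
  exact: (closure_min (closed_vanishes_at p) pA HL).
by apply: HL; split; [apply: Sh | move=> M /AZ; apply].
Qed.

(** The source of the homogeneous functions attached to a chain. *)
Lemma closed_separate Z L : zariski_closed Z -> ~ Z L ->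
  exists d p, [/\ p \is d.-homog, vanishing Z p & ~ vanishes_at p L].
Proof.
move=> [S [Sh ->]] /= /existsNP[p /not_implyP[Sp pL]].
have [d ph] := Sh p Sp; exists d, p; split=> // M; exact.
Qed.

(** The vanishing ideal of an irreducible set is prime.  Only one factor has to be
  homogeneous: off the zeros of g, the other factor vanishes on whole lines minus
  the origin, hence on whole lines. *)
Lemma irreducible_cancel Y g h d : irreducible Y -> g \is d.-homog ->
  ~ vanishing Y g -> vanishing Y (g * h) -> vanishing Y h.
Proof.
move=> [_ Yirr] gh gY ghY.
have := Yirr _ _ (closed_vanishes_at g) (closed_vanishes_at h).
case=> // L YL.
have [gL|gL] := pselect (vanishes_at g L); [by left | right].
have [v _ LE] := proj_vline L.
have gv : g.@[fun i => v 0 i] != 0.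
  by apply/eqP => gv; apply: gL; apply: (vanishes_at_homogP gh LE).
apply/(vanishes_atP h LE) => t; rewrite -along_scale.
have -> : along h (fun i => 'X * (v 0 i)%:P) = 0; last by rewrite horner0.
apply: (@poly_eq0_off _ 'X); first by rewrite polyX_eq0.
move=> s; rewrite hornerX along_scale => s0.
have /(vanishes_atP _ LE)/(_ s) := ghY L YL.
rewrite mevalM (homog_scale _ _ gh) => /eqP.
by rewrite !mulf_eq0 expf_eq0 (negPf s0) (negPf gv) andbF /= => /eqP.
Qed.

End VanishingIdeals.

(** * Algebraic dependence *)

Section AlgebraicDependence.
Variables (C : numFieldType) (n m : nat) (G : 'I_m -> {mpoly C[n]}).

Lemma msize_prod_le (I : finType) (F : I -> {mpoly C[n]}) (e : I -> nat) d :
  (forall i, msize (F i) <= d.+1)%N ->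
  (msize (\prod_i F i ^+ e i) <= ((\sum_i e i) * d).+1)%N.
Proof.
move=> HF.
have mulB p q x y :
    (msize p <= x.+1 -> msize q <= y.+1 -> msize (p * q : {mpoly C[n]}) <= (x + y).+1)%N.
  have [->|p0] := eqVneq p 0; first by rewrite mul0r msize0.
  have [->|q0] := eqVneq q 0; first by rewrite mulr0 msize0.
  by move=> Hp Hq; rewrite msizeM //; move: Hp Hq; move: (msize p) (msize q) => P Q; lia.
have expB p x k : (msize p <= x.+1 -> msize (p ^+ k : {mpoly C[n]}) <= (k * x).+1)%N.
  move=> Hp; elim: k => [|k IHk]; first by rewrite expr0 msize1.
  by rewrite exprS mulSn; apply: mulB.
rewrite big_distrl /=.
elim/big_ind2: _ => [|p x q y|i _]; [by rewrite msize1 | exact: mulB | exact: expB].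
Qed.

(** More polynomials than variables satisfy an algebraic relation: among the
  E^m monomials of exponents below E, composed with G, only O(E)^n coefficients
  can be nonzero. *)
Lemma algebraic_relation : (n < m)%N ->
  exists2 P : {mpoly C[m]}, P != 0 & P \mPo [tuple G i | i < m] = 0.
Proof.
move=> ltnm.
pose d := \max_i msize (G i).
have Gd i : (msize (G i) <= d.+1)%N.
  by apply: leqW; apply: (@leq_bigmax _ (fun i => msize (G i))).
(* E is chosen so that (K * E) ^ n < E ^ n.+1, where K * E bounds the degrees of
   all the composed monomials. *)
pose K := (m * d).+1; pose E := (K ^ n).+1; pose B := (K * E)%N.
pose A := {ffun 'I_m -> 'I_E}; pose Bx := {ffun 'I_n -> 'I_B}.
have ltBE : (#|Bx| < #|A|)%N.
  rewrite !card_ffun !card_ord (@leq_trans (E ^ n.+1)%N) //; last first.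
    by rewrite leq_pexp2l.
  by rewrite /B expnMn expnS ltn_mul2r expn_gt0 /= /E ltnS leqnn.
pose u (al : A) := \prod_i G i ^+ al i.
have u_small al : (msize (u al) <= B)%N.
  apply: leq_trans (msize_prod_le _ Gd) _.
  apply: (@leq_trans (m * E * d).+1).
    rewrite ltnS leq_mul2r; apply/orP; right.
    rewrite -[X in (_ <= X * _)%N]card_ord -sum_nat_const leq_sum // => i _.
    exact: ltnW.
  by rewrite /B /K; nia.
pose mn (be : Bx) : 'X_{1..n} := [multinom (be i : nat) | i < n].
pose M := \matrix_(i < #|A|, j < #|Bx|) (u (enum_val i))@_(mn (enum_val j)).
have : kermx M != 0.
  rewrite kermx_eq0; apply/negP => /eqP rM.
  by have := rank_leq_col M; rewrite rM leqNgt ltBE.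
case/rowV0Pn => c /sub_kermxP cM c0.
pose P : {mpoly C[m]} := \sum_(i < #|A|) c 0 i *: 'X_[[multinom (enum_val i j : nat) | j < m]].
have multinomA (al be : A) :
  [multinom (al j : nat) | j < m] = [multinom (be j : nat) | j < m] -> al = be.
  by move=> /mnmP H; apply/ffunP => j; apply: val_inj; have := H j; rewrite !mnmE.
exists P.
  apply: contraNneq c0 => P0; apply/eqP/rowP => i; rewrite mxE.
  have := congr1 (mcoeff [multinom (enum_val i j : nat) | j < m]) P0.
  rewrite mcoeff0 /P raddf_sum (bigD1 i) //= mcoeffZ mcoeffX eqxx mulr1.
  rewrite big1 ?addr0 // => k ki; rewrite mcoeffZ mcoeffX.
  case: eqP => [|]; last by rewrite mulr0.
  by move/multinomA/enum_val_inj => Eki; rewrite Eki eqxx in ki.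
have -> : P \mPo [tuple G i | i < m] = \sum_(i < #|A|) c 0 i *: u (enum_val i).
  rewrite raddf_sum; apply: eq_bigr => i _ /=.
  rewrite comp_mpolyZ comp_mpolyX; congr (_ *: _); apply: eq_bigr => j _.
  by rewrite tnth_mktuple mnmE.
apply/mpolyP => k; rewrite mcoeff0 raddf_sum /=.
have [Hk|/forallPn[i Hi]] := boolP [forall i, k i < B]%N; last first.
  rewrite big1 // => j _; rewrite mcoeffZ.
  have -> : (u (enum_val j))@_k = 0; last by rewrite mulr0.
  apply/eqP; rewrite mcoeff_eq0; apply: msize_mdeg_ge.
  apply: leq_trans (u_small _) _; rewrite mdegE (bigD1 i) //= -leqNgt in Hi *.
  exact: leq_trans Hi (leq_addr _ _).
pose be : Bx := [ffun i => Ordinal (forallP Hk i)].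
have kE : k = mn be by apply/mnmP => i; rewrite mnmE ffunE.
transitivity ((c *m M) 0 (enum_rank be)); last by rewrite cM mxE.
rewrite mxE; apply: eq_bigr => i _.
by rewrite mcoeffZ mxE enum_rankK -kE.
Qed.

End AlgebraicDependence.

(** * Regular sequences are algebraically independent *)

Section RegularSequences.
Variables (C : numFieldType) (m : nat).
Implicit Types P : {mpoly C[m]}.

Lemma mcoeff_subsum (Q : pred 'X_{1..m}) P k :
  (\sum_(l <- msupp P | Q l) P@_l *: 'X_[l])@_k = if Q k then P@_k else 0.
Proof.
rewrite raddf_sum /=.
have [pk|pk] := boolP (k \in msupp P); last first.
  have -> : P@_k = 0 by apply/eqP; rewrite mcoeff_eq0.
  rewrite if_same big_seq_cond big1 // => l /andP[pl _].
  by rewrite mcoeffZ mcoeffX; case: eqP => [Elk|]; [rewrite -Elk pl in pk | rewrite mulr0].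
rewrite big_mkcond (bigD1_seq k) ?msupp_uniq //= mcoeffZ mcoeffX eqxx mulr1.
rewrite big1 ?addr0 // => l /negPf lk.
by case: ifP => // _; rewrite mcoeffZ mcoeffX lk mulr0.
Qed.

(** P0 is the part of P without the variable j, and P' the quotient of the rest by
  that variable; the supports are recorded to control the variables that occur. *)
Lemma mpoly_split_var P (j : 'I_m) : exists P0 P',
  [/\ P = P0 + 'X_j * P',
      forall l, l \in msupp P0 -> l \in msupp P /\ l j = 0%N &
      forall l, l \in msupp P' -> (l + U_(j))%MM \in msupp P].
Proof.
exists (\sum_(l <- msupp P | l j == 0%N) P@_l *: 'X_[l]).
exists (\sum_(l <- msupp P | l j != 0%N) P@_l *: 'X_[l - U_(j)]).
have XE : 'X_j * (\sum_(l <- msupp P | l j != 0%N) P@_l *: 'X_[l - U_(j)])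
    = \sum_(l <- msupp P | l j != 0%N) P@_l *: 'X_[l].
  rewrite mulr_sumr; apply: eq_bigr => l lj.
  by rewrite -scalerAr -mpolyXD addmC submK // lep1mP.
split.
- by rewrite XE {1}[P]mpolyE (bigID (fun l : 'X_{1..m} => l j == 0%N)).
- move=> l; rewrite mcoeff_msupp mcoeff_subsum mcoeff_msupp.
  by case: (l j =P 0%N); rewrite ?eqxx.
- move=> l; rewrite !mcoeff_msupp [(l + _)%MM]addmC.
  rewrite -[X in X != 0 -> _](mcoeffMX _ U_(j)) mulrC XE mcoeff_subsum.
  by case: ifP; rewrite ?eqxx.
Qed.

Variables (n : nat) (g : 'I_m -> {mpoly C[n]}) (Id : nat -> {mpoly C[n]} -> Prop).
Hypothesis IdB : forall j p q, Id j p -> Id j q -> Id j (p - q).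
Hypothesis IdM : forall j p q, Id j p -> Id j (p * q).
Hypothesis IdS : forall j p, (j < m)%N -> Id j.+1 p -> Id j p.
Hypothesis Id0 : forall c, Id 0 c%:MP -> c = 0.
Hypothesis Idg : forall j : 'I_m, Id j (g j).
Hypothesis Idcancel : forall (j : 'I_m) p, Id j.+1 (g j * p) -> Id j.+1 p.

(** If each g_j lies in the j-th ideal of a decreasing sequence and is not a zero
  divisor modulo the next one, then the g_j are algebraically independent modulo
  the last ideal: a relation modulo the (j+1)-st ideal becomes, after setting
  the variable of g_j to 0, a relation among the previous elements modulo the
  j-th one; hence it is divisible by that variable, which can be cancelled. *)
Lemma regular_sequence_indep P :
  Id m (P \mPo [tuple g i | i < m]) -> P = 0.
Proof.
have main j : (j <= m)%N -> forall Q : {mpoly C[m]},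
    (forall l, l \in msupp Q -> forall i : 'I_m, (j <= i)%N -> l i = 0%N) ->
    Id j (Q \mPo [tuple g i | i < m]) -> Q = 0.
  elim: j => [_ Q Qs|j IHj jm Q].
    have -> : Q = (Q@_0)%:MP.
      apply/mpolyP => l; rewrite mcoeffC.
      have [->|l0] := eqVneq l 0%MM; first by rewrite mulr1.
      rewrite mulr0; apply/eqP; rewrite mcoeff_eq0; apply: contra l0 => /Qs H.
      by apply/eqP/mnmP => i; rewrite H // mnmE.
    by rewrite comp_mpolyC => /Id0 ->; rewrite mpolyC0.
  pose oj := Ordinal jm.
  have [s] := ubnP (msize Q); elim: s Q => // s IHs Q Qs Qj QId.
  have [Q0 [Q' [QE Q0s Q's]]] := mpoly_split_var Q oj.
  have XE : ('X_oj * Q') \mPo [tuple g i | i < m]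
      = g oj * (Q' \mPo [tuple g i | i < m]).
    by rewrite rmorphM /= comp_mpolyXU -tnth_nth tnth_mktuple.
  have Q00 : Q0 = 0.
    apply: (IHj (ltnW jm)) => [l /Q0s[lQ lj] i|].
      rewrite leq_eqVlt => /orP[/eqP Ej|/(Qj l lQ)//].
      by rewrite -lj; congr (l _); apply: val_inj.
    have -> : Q0 = Q - 'X_oj * Q' by rewrite {1}QE addrK.
    rewrite raddfB /= XE; apply: IdB; first exact: IdS.
    by apply: IdM; apply: (Idg oj).
  move: QE; rewrite Q00 add0r => QE.
  have [Q'0|Q'0] := eqVneq Q' 0; first by rewrite QE Q'0 mulr0.
  suff Q'E : Q' = 0 by rewrite QE Q'E mulr0.
  apply: IHs.
  - move: Qs; rewrite QE msizeM //; last by rewrite -msize_poly_eq0 msizeX.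
    by rewrite msizeX mdeg1 /= ltnS.
  - by move=> l /Q's lQ i ji; move: (Qj _ lQ i ji); rewrite mnmDE; lia.
  by apply: (Idcancel (j := oj)); rewrite -XE -QE.
by apply: main => // l _ i; rewrite leqNgt ltn_ord.
Qed.

End RegularSequences.

(** * An upper bound for chains of irreducible closed sets *)

Section ChainBound.
Variables (C : numFieldType) (n : nat).
Implicit Types (p g h : {mpoly C[n]}) (Y : set (proj C n)).

(** Successive members of a chain are separated by homogeneous polynomials.
  Together with a coordinate that does not vanish on the first member they form a
  regular sequence of length e + 1, hence they are algebraically independent on the
  last one; but their compositions with Psi are polynomials in M variables. *)
Lemma chain_bound Y M (Psi : 'I_n -> {mpoly C[M]}) :
  (forall p, p \mPo [tuple Psi i | i < n] = 0 -> vanishing Y p) ->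
  forall e c, irreducible_chain Y e c -> (e < M)%N.
Proof.
move=> HY e c [cP clt].
(* The sequence of ideals starts with the ideal of the origin, so that the first
   element of the regular sequence is any nonvanishing coordinate. *)
pose Id j p := if j is i.+1 then vanishing (c i) p else p.@[fun=> 0] = 0.
have Idsep (j : 'I_e.+1) : exists g, (exists d, g \is d.-homog) /\ Id j g /\ ~ Id j.+1 g.
  case: j => -[|j] /= je.
    have [_ [[L cL] _] _] := cP 0%N isT.
    have [v v0 LE] := proj_vline L.
    have [i vi] : exists i, v 0 i != 0.
      apply/existsP; apply: contraNT v0 => /existsPn vi.
      by apply/eqP/rowP => i; rewrite mxE; apply/eqP/negPn/vi.
    exists 'X_i; split; first by exists 1%N; rewrite dhomogX /= mdeg1.
    split; first by rewrite mevalXU.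
    move/(_ L cL v); rewrite LE memv_line mevalXU => /(_ isT) vi0.
    by rewrite vi0 eqxx in vi.
  have [cc _ _] := cP j (ltnW je).
  have [_ /nonsubset[L [cL ncL]]] := clt j je.
  have [d [g [gd gc gL]]] := closed_separate cc ncL.
  by exists g; split; [exists d | split=> // /(_ L cL)].
have {Idsep} [g gP] := choice Idsep.
have gh j := (gP j).1; have gId j := (gP j).2.1; have gNId j := (gP j).2.2.
rewrite ltnNge; apply/negP => eM.
have [P P0 PE] := algebraic_relation
  (fun j => g j \mPo [tuple Psi i | i < n]) (eM : (M < e.+1)%N).
case/eqP: P0; apply: (regular_sequence_indep (g := g) (Id := Id)).
- case=> [|j] p q /=; first by rewrite mevalB => -> ->; rewrite subr0.
  by move=> pj qj L cL v vL; rewrite mevalB (pj L cL v vL) (qj L cL v vL) subr0.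
- case=> [|j] p q /=; first by rewrite mevalM => ->; rewrite mul0r.
  by move=> pj L cL v vL; rewrite mevalM (pj L cL v vL) mul0r.
- case=> [|j] p /= je pj; last first.
    by move=> L cL; have [cs _] := clt j je; apply: pj (cs L cL).
  have [_ [[L cL] _] _] := cP 0%N isT.
  by apply: etrans (pj L cL 0 (mem0v _)); apply: meval_eq => i; rewrite mxE.
- by move=> b /=; rewrite mevalC.
- exact: gId.
- move=> j p /=; have [d gd] := gh j.
  have [_ cirr _] := cP j (ltn_ord j).
  by apply: (irreducible_cancel cirr gd (gNId j)).
have [_ _ cY] := cP e (leqnn e).
move=> L /cY; apply: HY; apply: mpoly_eq0_meval => x.
rewrite !comp_mpoly_meval -[RHS](meval0 x) -PE comp_mpoly_meval.
apply: meval_eq => i; rewrite !tnth_mktuple comp_mpoly_meval.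
by apply: meval_eq => k; rewrite !tnth_mktuple.
Qed.

End ChainBound.

(** * Chains inside a parametrized set *)

Section LowestTerm.
Variables (C : numFieldType) (m : nat).

(** Substituting a perturbation of the identity of higher order leaves the
  homogeneous part of lowest degree unchanged. *)
Lemma lowest_term_eq0 (P : {mpoly C[m]}) :
  (forall x, exists W : 'I_m -> {poly C},
     (forall i, (W i).[0] = x i) /\ along P (fun i => 'X * W i) = 0) -> P = 0.
Proof.
move=> HP; apply/eqP/negPn/negP => P0.
have : exists s, pihomog mdeg s P != 0.
  apply: contrapT => /forallNP H; move: P0.
  rewrite [P](pihomog_partitionE (mf := mdeg) (leqnn _)) big1 ?eqxx // => d _.
  by apply/eqP/negPn/negP/H.
case/ex_minnP => s Ps smin; case/eqP: Ps; apply: mpoly_eq0_meval => x.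
have [W [W0 HW]] := HP x.
pose A d := along (pihomog mdeg d P) W.
pose k := maxn s.+1 (msize P).
(* The restriction of P to the curve, divided by the s-th power of the parameter
   whose value at 0 is the component of degree s of P at x. *)
have HW2 : 'X ^+ s * (A s + 'X * \sum_(d < k | (s < d)%N) 'X ^+ (d - s.+1) * A d) = 0.
  rewrite -{}[RHS]HW [X in along X](pihomog_partitionE (mf := mdeg) (leq_maxr s.+1 (msize P))).
  have -> : along (\sum_(d < k) pihomog mdeg d P) (fun i => 'X * W i)
     = \sum_(d < k) along (pihomog mdeg d P) (fun i => 'X * W i) by exact: raddf_sum.
  have scale d : along (pihomog mdeg d P) (fun i => 'X * W i) = 'X ^+ d * A d.
    apply/eqP; rewrite -subr_eq0; apply/eqP.
    apply: (@poly_eq0_off _ 1); first exact: oner_neq0.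
    move=> t _; rewrite hornerD hornerN hornerM hornerXn !alongE.
    rewrite -(homog_scale _ _ (pihomogP mdeg d P)); apply/eqP; rewrite subr_eq0; apply/eqP.
    by apply: meval_eq => i; rewrite hornerM hornerX.
  have sk : (s < k)%N by rewrite /k leq_maxl.
  rewrite [RHS](bigD1 (Ordinal sk)) //= scale mulrDr; congr (_ + _).
  rewrite [RHS](bigID (fun d : 'I_k => s < d)%N) /= [X in _ = _ + X]big1 ?addr0; last first.
    move=> d /andP[ds dls]; rewrite scale.
    suff -> : A d = 0 by rewrite mulr0.
    rewrite /A.
    have -> : pihomog mdeg d P = 0.
      apply: contraNeq dls => /smin; rewrite leq_eqVlt => /orP[/eqP E|//].
      by case/eqP: ds; apply: val_inj.
    exact: mmap0.
  rewrite mulrA -exprSr mulr_sumr; apply: eq_big => [d|d sd].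
    by apply/idP/andP => [sd|[]//]; split=> //; rewrite -val_eqE /= neq_ltn sd orbT.
  by rewrite scale mulrA -exprD subnKC.
move/eqP: HW2; rewrite mulf_eq0 expf_eq0 polyX_eq0 andbF /= => /eqP HW2.
have := congr1 (fun p => p.[0]) HW2.
rewrite horner0 hornerD hornerM hornerX mul0r addr0 alongE => <-.
by apply: meval_eq => i; rewrite W0.
Qed.

End LowestTerm.

(** The polynomials f_j parametrize a set by d variables.  The rows of K are the image
  of the origin and the partial derivatives there; that they are free means that
  the cone over the image has d + 1 independent tangent directions at that point. *)
Section ChainConstruction.
Variables (C : numFieldType) (n d : nat) (f : 'I_n -> {mpoly C[d]}).
Variable K : 'M[C]_(d.+1, n).
Hypothesis K_free : row_free K.
Hypothesis fE : forall (x : 'I_d -> C) (j : 'I_n), exists q,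
  along (f j) (fun i => 'X * (x i)%:P) =
  (K 0 j)%:P + 'X * (\sum_i x i * K (lift ord0 i) j)%:P + 'X^2 * q.
Local Open Scope classical_set_scope.

Definition param_point (t : 'I_d -> C) : 'rV[C]_n := \row_j (f j).@[t].

Definition param_image (r : nat) : set (proj C n) :=
  [set L | exists t : 'I_d -> C, (forall i : 'I_d, (r <= i)%N -> t i = 0) /\
     val L = <[param_point t]>%VS].

Lemma along_param (x : 'I_d -> C) j t :
  (along (f j) (fun i => 'X * (x i)%:P)).[t] = param_point (fun i => t * x i) 0 j.
Proof. by rewrite alongE mxE; apply: meval_eq => i; rewrite !hornerE. Qed.

Lemma param_point0 : param_point (fun=> 0) = row 0 K.
Proof.
apply/rowP => j; have [q Hq] := fE (fun=> 0) j.
rewrite [RHS]mxE; have := along_param (fun=> 0) j 0.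
rewrite Hq !hornerE expr0n mul0r addr0 => ->.
by rewrite !mxE; apply: meval_eq => i; rewrite /= ?mulr0.
Qed.

Lemma row0K_neq0 : row 0 K != 0.
Proof.
rewrite rowE; apply/eqP => H.
have /(row_free_inj K_free)/rowP/(_ 0) : delta_mx 0 0 *m K = (0 : 'rV_d.+1) *m K.
  by rewrite H mul0mx.
by rewrite !mxE !eqxx => /eqP; rewrite oner_eq0.
Qed.

(** Two nonvanishing polynomials on the image are both nonzero at a common point: join
  two points where they do not vanish by a segment in the parameter space. *)
Lemma param_image_irreducible r : irreducible (zariski_closure (param_image r)).
Proof.
have K0 := row0K_neq0; rewrite -param_point0 in K0.
split.
  exists (proj_point K0); apply: subset_closure.
  by exists (fun=> 0); split.
move=> Z1 Z2 cZ1 cZ2 ZZ; apply: contrapT => /not_orP[nZ1 nZ2].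
have witness Z : zariski_closed Z -> ~ (zariski_closure (param_image r) `<=` Z) ->
  exists p t, [/\ vanishing Z p, forall i : 'I_d, (r <= i)%N -> t i = 0,
    param_point t != 0 & p.@[fun j => param_point t 0 j] != 0].
  move=> cZ nZ; have /nonsubset[L [[t [tr LE]] nL]] : ~ (param_image r `<=` Z).
    by move=> H; apply: nZ; apply: closure_min.
  have [e [p [ph pZ npL]]] := closed_separate cZ nL.
  exists p, t; split=> //; last first.
    by apply/eqP => pt; apply: npL; apply: (vanishes_at_homogP ph LE).
  by have := valP L; rewrite /= LE dim_vline; case: (_ != 0).
have [p1 [t1 [p1Z t1r f1 p1t]]] := witness _ cZ1 nZ1.
have [p2 [t2 [p2Z t2r _ p2t]]] := witness _ cZ2 nZ2.
have {f1} [j fj] : exists j, param_point t1 0 j != 0.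
  apply/existsP; apply: contraNT f1 => /existsPn H.
  by apply/eqP/rowP => j; rewrite [RHS]mxE; apply/eqP/negPn/H.
pose w : 'I_d -> {poly C} := segment t1 (fun i => t2 i - t1 i).
pose pt s := fun i => (w i).[s].
pose F i : {poly C} := along (f i) w.
have FE s i : (F i).[s] = param_point (pt s) 0 i by rewrite alongE mxE.
have pt0 : pt 0 = t1 by apply: funext => i; rewrite /pt segmentE mul0r addr0.
have pt1 : pt 1 = t2 by apply: funext => i; rewrite /pt segmentE mul1r addrC subrK.
have pE p s : (along p F).[s] = p.@[fun i => param_point (pt s) 0 i].
  by rewrite alongE; apply: meval_eq => i; rewrite FE.
have nz (u : {poly C}) s : u.[s] != 0 -> u != 0.
  by apply: contraNneq => ->; rewrite horner0.
have [|s] := @poly_nonroot _ (along p1 F * along p2 F * F j).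
  rewrite !mulf_neq0 //; first 1 [apply: (nz _ 0); rewrite pE pt0 //|].
  - by apply: (nz _ 1); rewrite pE pt1.
  - by apply: (nz _ 0); rewrite FE pt0.
rewrite !hornerM !mulf_eq0 !negb_or !pE FE => /andP[/andP[p1s p2s] fs].
have pt_neq0 : param_point (pt s) != 0.
  by apply: contraNneq fs => ->; rewrite mxE.
have pts : param_image r (proj_point pt_neq0).
  exists (pt s); split=> // i ri.
  by rewrite /pt segmentE t1r // t2r // subrr mulr0 addr0.
have in_line : param_point (pt s) \in val (proj_point pt_neq0) by apply: memv_line.
case: (ZZ _ (subset_closure pts)) => [/p1Z/(_ _ in_line) p0|/p2Z/(_ _ in_line) p0].
  by rewrite p0 eqxx in p1s.
by rewrite p0 eqxx in p2s.
Qed.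

Lemma param_image_chain_mono r :
  zariski_closure (param_image r) `<=` zariski_closure (param_image r.+1).
Proof.
apply: closure_mono => L [t [tr LE]]; exists t; split=> // i ri.
exact/tr/ltnW.
Qed.

(** The coordinates dual to the free rows of K, re-centred at the image of the
  origin, are r+2 functions; on the cone over the r-dimensional image they depend
  on r+1 parameters, hence satisfy a relation, but on the cone over the next image
  they form a local coordinate system and satisfy none. *)
Lemma param_image_chain_strict r : (r < d)%N ->
  ~ (zariski_closure (param_image r.+1) `<=` zariski_closure (param_image r)).
Proof.
move=> rd Hsub.
pose Pi := pinvmx K; have KPi : K *m Pi = 1%:M by apply: mulmxVp.
pose wid (i : 'I_r.+2) : 'I_d.+1 := widen_ord (rd : (r.+2 <= d.+1)%N) i.
pose Lf (i : 'I_r.+2) : {mpoly C[n]} :=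
  \sum_j Pi j (wid i) *: 'X_j - (i == ord0)%:R%:MP.
have LfE i v : (Lf i).@[v] = \sum_j Pi j (wid i) * v j - (i == ord0)%:R.
  rewrite mevalB mevalC raddf_sum /=; congr (_ - _).
  by apply: eq_bigr => j _; rewrite mevalZ mevalXU.
(* The variable 0 is the scaling parameter of the cone, the variable i.+1 is the
   i-th parameter of the image. *)
pose ext (t : 'I_r.+1 -> C) : 'I_d -> C :=
  fun i => if (i < r)%N then t (inord i.+1) else 0.
pose fr j : {mpoly C[r.+1]} := 'X_ord0 *
  (f j \mPo [tuple (if (i < r)%N then 'X_(inord i.+1) else 0) | i < d]).
have frE j t : (fr j).@[t] = t ord0 * param_point (ext t) 0 j.
  rewrite mevalM mevalXU comp_mpoly_meval mxE; congr (_ * _).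
  apply: meval_eq => i; rewrite tnth_mktuple /ext.
  by case: ifP => _; rewrite ?mevalXU ?meval0.
have [P P0 PE] := algebraic_relation
  (fun i => Lf i \mPo [tuple fr j | j < n]) (ltnSn r.+1).
pose p := P \mPo [tuple Lf i | i < r.+2].
have pE v : p.@[v] = P.@[fun i => (Lf i).@[v]].
  by rewrite comp_mpoly_meval; apply: meval_eq => i; rewrite tnth_mktuple.
have : vanishing (param_image r) p.
  move=> L [t [tr LE]]; apply/(vanishes_atP _ LE) => la.
  pose s (i : 'I_r.+1) : C :=
    if unlift ord0 i is Some i' then t (widen_ord (ltnW rd) i') else la.
  have exts : ext s = t.
    apply: funext => i; rewrite /ext; case: ltnP => [ir|/tr ->//].
    rewrite /s; have -> : inord i.+1 = lift ord0 (Ordinal ir) :> 'I_r.+1.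
      by apply: val_inj; rewrite /= inordK.
    by rewrite liftK; congr (t _); apply: val_inj.
  have := congr1 (meval s) PE; rewrite meval0 comp_mpoly_meval => <-.
  rewrite pE; apply: meval_eq => i.
  rewrite tnth_mktuple comp_mpoly_meval; apply: meval_eq => j.
  by rewrite tnth_mktuple frE exts /s unlift_none.
move/vanishing_closure => pZ.
have {pZ} pZ : vanishing (param_image r.+1) p.
  by move=> L /subset_closure/Hsub; apply: pZ.
case/eqP: P0; apply: lowest_term_eq0 => x.
pose xt (i : 'I_d) : C := if (i < r.+1)%N then x (inord i.+1) else 0.
have /choice[q Hq] := fE xt.
(* A curve in the cone through the base point, with direction x in the dual
   coordinates. *)
pose mu : {poly C} := 1 + 'X * (x ord0)%:P.
pose cone j : {poly C} := mu * along (f j) (fun i => 'X * (xt i)%:P).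
pose a (i : 'I_r.+2) : C := if i == ord0 then 0 else x i.
pose Q (i : 'I_r.+2) : {poly C} := \sum_j (Pi j (wid i))%:P * q j.
pose W (i : 'I_r.+2) : {poly C} := (x i)%:P + 'X * ((x ord0 * a i)%:P + mu * Q i).
have dual k i : \sum_j Pi j (wid i) * K k j = (k == wid i)%:R.
  transitivity ((K *m Pi) k (wid i)); last by rewrite KPi mxE.
  by rewrite mxE; apply: eq_bigr => j _; rewrite mulrC.
have coneE (i : 'I_r.+2) :
  \sum_j (Pi j (wid i))%:P * cone j - (i == ord0)%:R = 'X * W i.
  transitivity (mu * ((\sum_j Pi j (wid i) * K 0 j)%:P
      + 'X * (\sum_j Pi j (wid i) * (\sum_l xt l * K (lift ord0 l) j))%:P
      + 'X^2 * Q i) - (i == ord0)%:R).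
    congr (_ - _); rewrite /Q !rmorph_sum !mulr_sumr -!big_split /= mulr_sumr.
    by apply: eq_bigr => j _; rewrite /cone Hq !polyCM; ring.
  have -> : \sum_j Pi j (wid i) * (\sum_l xt l * K (lift ord0 l) j) = a i.
    under eq_bigr do rewrite mulr_sumr.
    rewrite exchange_big /=.
    transitivity (\sum_l xt l * (lift ord0 l == wid i)%:R).
      apply: eq_bigr => l _; rewrite -dual mulr_sumr.
      by apply: eq_bigr => j _; rewrite mulrCA.
    rewrite /a; case: (unliftP ord0 i) => [i'|] ->; last first.
      rewrite eqxx big1 // => l _.
      suff -> : (lift ord0 l == wid ord0) = false by rewrite mulr0.
      by apply/eqP => /(congr1 val).
    have i'd : (i' < d)%N by apply: leq_trans (ltn_ord i') rd.
    have -> : (lift ord0 i' == ord0) = false by apply/eqP => /(congr1 val).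
    rewrite (bigD1 (Ordinal i'd)) //= big1 ?addr0 => [|l li]; last first.
      suff -> : (lift ord0 l == wid (lift ord0 i')) = false by rewrite mulr0.
      apply: contraNF li => /eqP/(congr1 val) /= [E]; apply/eqP/val_inj.
      by move: E; rewrite /bump /= => -[].
    have -> : (lift ord0 (Ordinal i'd) == wid (lift ord0 i')) by apply/eqP/val_inj.
    rewrite mulr1 /xt /= (ltn_ord i'); congr (x _); apply: val_inj.
    by rewrite /= inordK // ltnS; apply: ltn_ord.
  rewrite dual (_ : (0 == wid i) = (i == ord0)); last first.
    by rewrite eq_sym -!val_eqE.
  rewrite /W /a /mu; case: eqP => [->|_];
    rewrite ?mulr1n ?mulr0n ?polyCM ?polyC0 ?polyC1; ring.
exists W; split; first by move=> i; rewrite /W !hornerE.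
have [j0 Kj0] : exists j, K 0 j != 0.
  apply/existsP; apply: contraNT row0K_neq0 => /existsPn H.
  by apply/eqP/rowP => j; rewrite !mxE; apply/eqP/negPn/H.
apply: (@poly_eq0_off _ (along (f j0) (fun i => 'X * (xt i)%:P))).
  apply: contraNneq Kj0 => /(congr1 (fun u => u.[0])).
  by rewrite horner0 Hq !hornerE expr0n mul0r addr0 => ->.
move=> t; rewrite along_param => ft; rewrite alongE.
have pt0 : param_point (fun i => t * xt i) != 0 by apply: contraNneq ft => ->; rewrite mxE.
have ptE : val (proj_point pt0) = <[param_point (fun i => (t * xt i : C))]>%VS by [].
have /pZ/(vanishes_atP _ ptE)/(_ (1 + t * x ord0)) : param_image r.+1 (proj_point pt0).
  exists (fun i => t * xt i); split=> // i; rewrite leqNgt /xt => /negPf ->.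
  by rewrite mulr0.
rewrite pE => <-; apply: meval_eq => i; rewrite -coneE LfE.
rewrite hornerD hornerN -polyC_natr hornerC; congr (_ - _).
rewrite horner_sum; apply: eq_bigr => j _.
by rewrite /cone /mu !hornerM along_param !hornerE.
Qed.


Lemma param_chain : exists c, irreducible_chain (zariski_closure (param_image d)) d c.
Proof.
exists (fun r => zariski_closure (param_image r)); split=> r rd.
  split; [exact: closed_closure | exact: param_image_irreducible |].
  rewrite -(subnKC rd); elim: (d - r)%N => [|k IHk]; first by rewrite addn0.
  by rewrite addnS; apply: subset_trans IHk _; apply: param_image_chain_mono.
split; [exact: param_image_chain_mono | exact: param_image_chain_strict].
Qed.

End ChainConstruction.

(** * Tangent vectors of Segre varieties in coordinates *)

Section Tensors.
Variable R : comNzRingType.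
Implicit Types (q : nat) (v tau : nat -> nat -> R) (J : nat -> nat) (lam : R).

Definition segre_coord q v J : R := \prod_(i < q) v i (J i).

Definition segre_cofactor q v i J : R := \prod_(j < q | (j : nat) != i) v j (J j).

(** The differential of (v_0, ..., v_(q-1)) |-> v_0 (x) ... (x) v_(q-1) in the
  direction tau, plus lam times the tensor itself. *)
Definition tangent_coord q lam v tau J : R :=
  lam * segre_coord q v J + \sum_(i < q) tau i (J i) * segre_cofactor q v i J.

Lemma segre_coordS q v J : segre_coord q.+1 v J = segre_coord q v J * v q (J q).
Proof. by rewrite /segre_coord big_ord_recr. Qed.

Lemma segre_cofactorS q v i J : segre_cofactor q.+1 v i J =
  if q == i then segre_coord q v J else segre_cofactor q v i J * v q (J q).
Proof.
rewrite /segre_cofactor big_mkcond big_ord_recr -big_mkcond /=.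
case: eqVneq => [->|_] //=.
rewrite mulr1 /segre_coord; apply: eq_bigl => j.
by rewrite neq_ltn ltn_ord.
Qed.

Lemma tangent_coordS q lam v tau J : tangent_coord q.+1 lam v tau J =
  tangent_coord q lam v tau J * v q (J q) + segre_coord q v J * tau q (J q).
Proof.
rewrite /tangent_coord segre_coordS big_ord_recr /= segre_cofactorS eqxx.
rewrite (eq_bigr (fun i : 'I_q => tau i (J i) * segre_cofactor q v i J * v q (J q))).
  by rewrite -mulr_suml mulrDl -!addrA mulrA [tau q _ * _]mulrC.
by move=> i _; rewrite segre_cofactorS gtn_eqF //= mulrA.
Qed.

Lemma eq_segre_coord q v v' J J' :
  (forall i, (i < q)%N -> v i (J i) = v' i (J' i)) ->
  segre_coord q v J = segre_coord q v' J'.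
Proof. by move=> H; apply: eq_bigr => i _; apply: H. Qed.

Lemma eq_tangent_coord q lam v tau v' tau' J J' :
  (forall i, (i < q)%N -> v i (J i) = v' i (J' i)) ->
  (forall i, (i < q)%N -> tau i (J i) = tau' i (J' i)) ->
  tangent_coord q lam v tau J = tangent_coord q lam v' tau' J'.
Proof.
move=> Hv Ht; rewrite /tangent_coord (eq_segre_coord Hv); congr (_ + _).
apply: eq_bigr => i _; rewrite Ht //; congr (_ * _).
by apply: eq_bigr => j _; apply: Hv.
Qed.

Lemma tangent_coord_notau q lam v tau J :
  (forall i, (i < q)%N -> tau i (J i) = 0) ->
  tangent_coord q lam v tau J = lam * segre_coord q v J.
Proof.
by move=> H; rewrite /tangent_coord big1 ?addr0 // => i _; rewrite H ?mul0r.
Qed.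

End Tensors.

(** * Linear independence as an open condition *)

Section Matrices.
Variable C : numFieldType.

Lemma row_freePn_vec (m n : nat) (M : 'M[C]_(m, n)) :
  (forall u : 'rV_m, u *m M = 0 -> u = 0) -> row_free M.
Proof.
move=> H; rewrite -kermx_eq0; apply/negPn/negP => /rowV0Pn[u /sub_kermxP uM].
by rewrite (H u uM) eqxx.
Qed.

(** The witness g is the determinant of the product of M with a right inverse of its
  value at t0. *)
Lemma row_free_open (m n : nat) (M : 'M[{poly C}]_(m, n)) t0 :
  row_free (map_mx (horner_eval t0) M) ->
  exists2 g : {poly C}, g != 0 &
    forall t, g.[t] != 0 -> row_free (map_mx (horner_eval t) M).
Proof.
move=> /row_freeP[B MB]; pose g := \det (M *m map_mx (@polyC C) B).
have gE t : g.[t] = \det (map_mx (horner_eval t) M *m B).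
  rewrite -horner_evalE -det_map_mx map_mxM; congr (\det (_ *m _)).
  by apply/matrixP => i j; rewrite !mxE; apply: hornerC.
exists g => [|t gt].
  have : g.[t0] != 0 by rewrite gE MB det1 oner_neq0.
  by apply: contraNneq => ->; rewrite horner0.
apply: row_freePn_vec => u uM.
have : u *m (map_mx (horner_eval t) M *m B) = 0 by rewrite mulmxA uM mul0mx.
rewrite gE -unitfE -/(_ \in unitmx) in gt.
by move/(congr1 (mulmx^~ (invmx (map_mx (horner_eval t) M *m B)))); rewrite mulmxK ?mul0mx.
Qed.

Lemma indepP (A X : finType) (P : pred A) (G : A -> X -> C) :
  row_free (\matrix_(i < #|P|, j < #|X|) G (enum_val i) (enum_val j)) <->
  forall c : A -> C, (forall a, ~~ P a -> c a = 0) ->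
    (forall x, \sum_a c a * G a x = 0) -> forall a, c a = 0.
Proof.
set M := \matrix_(i, j) _.
have sumE (c : A -> C) x : (forall a, ~~ P a -> c a = 0) ->
    \sum_a c a * G a x = ((\row_i c (enum_val i)) *m M) 0 (enum_rank x).
  move=> cP; rewrite (bigID P) /= addrC big1 ?add0r => [|a /cP ->]; last by rewrite mul0r.
  rewrite big_enum_val mxE; apply: eq_bigr => i _.
  by rewrite !mxE enum_rankK.
split=> [Mf c cP cG a|H].
  have [Pa|/cP//] := boolP (P a).
  have c0 : \row_i c (enum_val i) = 0 :> 'rV_#|P|.
    apply: (row_free_inj Mf); rewrite mul0mx; apply/rowP => j.
    by rewrite -(enum_valK j) -sumE // cG mxE.
  by have /rowP/(_ (enum_rank_in Pa a)) := c0; rewrite !mxE enum_rankK_in.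
apply: row_freePn_vec => u uM.
pose c a := \sum_(i | enum_val i == a) u 0 i.
have cE i : c (enum_val i) = u 0 i.
  by rewrite /c (eq_bigl (pred1 i)) ?big_pred1_eq // => j; rewrite (inj_eq enum_val_inj).
have cP a : ~~ P a -> c a = 0.
  move=> Pa; apply: big_pred0 => i; apply: contraNF Pa => /eqP <-.
  exact: enum_valP.
apply/rowP => i; rewrite [RHS]mxE -cE; apply: H => // x.
rewrite sumE // (_ : \row_i _ = u) ?uM ?mxE //.
by apply/rowP => j; rewrite mxE cE.
Qed.

End Matrices.

(** * Tangent spaces in direct sum *)

Section DirectSums.
Variable C : numFieldType.

Definition in_box q (a J : nat -> nat) : Prop := forall i, (i < q)%N -> (J i <= a i)%N.

(** Every p in T carries a point v p and the set D p of pairs (i, l) such that the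
  l-th coordinate direction of the i-th factor is allowed at p.  The tensors and
  all their allowed derivatives must be linearly independent.  With all
  directions l different from a pivot in every factor, these vectors are D_q
  independent elements of the tangent space; with no direction at all, only
  the point itself remains. *)
Definition direct (T : finType) q (a : nat -> nat) (D : T -> nat -> nat -> bool)
    (v : T -> nat -> nat -> C) : Prop :=
  forall (lam : T -> C) (tau : T -> nat -> nat -> C),
    (forall p i l, ~~ D p i l -> tau p i l = 0) ->
    (forall J, in_box q a J -> \sum_p tangent_coord q (lam p) (v p) (tau p) J = 0) ->
    forall p, lam p = 0 /\
      forall i l, (i < q)%N -> (l <= a i)%N -> tau p i l = 0.

Section Matrix.
Variables (T : finType) (q : nat) (a : nat -> nat) (D : T -> nat -> nat -> bool).

Let m := (\max_(i < q) a i).+1.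

Lemma box_lt_max J i : in_box q a J -> (i < q)%N -> (J i < m)%N.
Proof.
move=> HJ iq; rewrite ltnS (leq_trans (HJ i iq)) //.
exact: (@leq_bigmax _ (fun i : 'I_q => a i) (Ordinal iq)).
Qed.

(** Index type of the family of vectors: inl p is the tensor at p itself, and
  inr (p, (i, l)) its derivative in the l-th direction of the i-th factor. *)
Definition direction : finType := (T + T * ('I_q * 'I_m))%type.

Definition allowed : pred direction := fun x =>
  match x with inl _ => true | inr (p, (i, l)) => D p i l && (l <= a i)%N end.

Definition direction_vector (R : comNzRingType) (v : T -> nat -> nat -> R)
    (x : direction) (J : nat -> nat) : R :=
  match x with
  | inl p => segre_coord q (v p) J
  | inr (p, (i, l)) => (J i == l)%:R * segre_cofactor q (v p) i J
  end.

Lemma sum_direction_vector (v : T -> nat -> nat -> C) (c : direction -> C)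
    (lam : T -> C) (tau : T -> nat -> nat -> C) J :
  in_box q a J ->
  (forall p, c (inl p) = lam p) ->
  (forall p (i : 'I_q) (l : 'I_m), (l <= a i)%N -> c (inr (p, (i, l))) = tau p i l) ->
  \sum_x c x * direction_vector v x J = \sum_p tangent_coord q (lam p) (v p) (tau p) J.
Proof.
move=> HJ clam ctau; rewrite big_sumType /=.
transitivity (\sum_p c (inl p) * segre_coord q (v p) J + \sum_p \sum_(i < q) \sum_(l < m)
    c (inr (p, (i, l))) * ((J i == l)%:R * segre_cofactor q (v p) i J)).
  congr (_ + _); under [RHS]eq_bigr do rewrite pair_bigA.
  by rewrite pair_bigA; apply: eq_bigr => -[p [i l]].
rewrite -big_split /=; apply: eq_bigr => p _.
rewrite clam; congr (_ + _); apply: eq_bigr => i _.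
rewrite (bigD1 (Ordinal (box_lt_max HJ (ltn_ord i)))) //= eqxx mul1r ctau; last exact: HJ.
rewrite big1 ?addr0 // => l lJ; suff -> : (J i == l) = false by rewrite mul0r mulr0.
by apply: contraNF lJ => /eqP JE; apply/eqP/val_inj.
Qed.

(** Coordinates of the tensor space; tuples of naturals J, bounded by a, are used
  wherever the finite type is not needed. *)
Definition box : finType := {dffun forall i : 'I_q, 'I_(a i).+1}.

Definition box_fun (J : box) (i : nat) : nat := if insub i is Some o then J o else 0%N.

Lemma box_funE (J : box) (i : 'I_q) : box_fun J i = J i.
Proof. by rewrite /box_fun valK. Qed.

Lemma box_fun_in_box J : in_box q a (box_fun J).
Proof. by move=> i iq; rewrite -[ i ]/(val (Ordinal iq)) box_funE -ltnS ltn_ord. Qed.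

Lemma box_funK J : in_box q a J -> exists J' : box, forall i, (i < q)%N -> box_fun J' i = J i.
Proof.
move=> HJ; exists [ffun i : 'I_q => inord (J i)] => i iq.
by rewrite -[ i ]/(val (Ordinal iq)) box_funE ffunE inordK // ltnS HJ.
Qed.

Definition direction_matrix (R : comNzRingType) (v : T -> nat -> nat -> R) :
  'M[R]_(#|allowed|, #|box|) :=
  \matrix_(i, j) direction_vector v (enum_val i) (box_fun (enum_val j)).

Lemma direct_row_free v : direct q a D v <-> row_free (direction_matrix v).
Proof.
have H := indepP allowed (fun x (J : box) => direction_vector v x (box_fun J)).
rewrite /direction_matrix; split=> [Hd|/H{}H].
  apply/H => c cP c0.
  pose tau p i l := if insub i is Some i' then
      if insub l is Some l' then
        if D p i l && (l <= a i)%N then c (inr (p, (i', l'))) else 0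
      else 0 else 0.
  have Hr J : in_box q a J -> \sum_p tangent_coord q (c (inl p)) (v p) (tau p) J = 0.
    move=> /box_funK[J' J'E]; rewrite -[RHS](c0 J').
    have := @sum_direction_vector v c (fun p => c (inl p)) tau _ (box_fun_in_box J').
    move=> ->//; last first.
      move=> p i l li; rewrite /tau !valK.
      by case: ifP => // /negbT HD; apply: cP.
    by apply: eq_bigr => p _; apply: eq_tangent_coord => i /J'E ->.
  have tauP p i l : ~~ D p i l -> tau p i l = 0.
    move=> /negPf nD; rewrite /tau nD; by case: insub => // ?; case: insub.
  have := Hd _ _ tauP Hr.
  move=> {}Hd [p|[p [i l]]]; first by have [] := Hd p.
  have [Pa|] := boolP (allowed (inr (p, (i, l)))); last exact: cP.
  have [_ /(_ i l (ltn_ord _))] := Hd p.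
  by case/andP: (Pa) => _ li /(_ li); rewrite /tau !valK (Pa : D p i l && _).
move=> lam tau tauP Hr.
pose c (x : direction) : C := match x with
  | inl p => lam p | inr (p, (i, l)) => if (l <= a i)%N then tau p i l else 0 end.
have cP x : ~~ allowed x -> c x = 0.
  case: x => [//|[p [i l]]] /=.
  by case: leqP => _; rewrite ?andbT // => /tauP.
have c0 J : \sum_x c x * direction_vector v x (box_fun J) = 0.
  rewrite (@sum_direction_vector v c lam tau); first exact/Hr/box_fun_in_box.
  - exact: box_fun_in_box.
  - by [].
  - by move=> p i l /= ->.
move=> p; split; first exact: (H c cP c0 (inl p)).
move=> i l iq la.
have lm : (l < m)%N.
  apply: (leq_ltn_trans la); rewrite ltnS.
  exact: (@leq_bigmax _ (fun i : 'I_q => a i) (Ordinal iq)).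
by have := H c cP c0 (inr (p, (Ordinal iq, Ordinal lm))); rewrite /= la.
Qed.

End Matrix.
End DirectSums.

Arguments allowed {T} q a D _.
Arguments direction_matrix {T} q a D {R} v.
Arguments direct_row_free {C T q a D v}.

Section Genericity.
Variables (C : numFieldType).

Definition open_along_lines (T : Type) (P : (T -> nat -> nat -> C) -> Prop) : Prop :=
  forall v w, P v -> exists2 g : {poly C}, g != 0 &
    forall t, g.[t] != 0 -> P (fun p i l => v p i l + t * w p i l).

(** Finitely many nonempty open conditions hold simultaneously: move from a
  configuration satisfying the first ones towards one satisfying the last one. *)
Lemma open_common (T : Type) (P : nat -> (T -> nat -> nat -> C) -> Prop) N :
  (forall B, (B < N)%N -> open_along_lines (P B)) ->
  (forall B, (B < N)%N -> exists v, P B v) ->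
  exists v, forall B, (B < N)%N -> P B v.
Proof.
move=> Popen Pex.
suff [] : open_along_lines (fun v => forall B, (B < N)%N -> P B v) /\
    exists v, forall B, (B < N)%N -> P B v by [].
elim: N Popen Pex => [|N IHN] Popen Pex.
  split; last by exists (fun _ _ _ => 0).
  by move=> v w _; exists 1; [exact: oner_neq0 |].
have [Qopen [v0 Qv0]] := IHN (fun B BN => Popen B (ltnW BN)) (fun B BN => Pex B (ltnW BN)).
have [v1 Pv1] := Pex N (ltnSn N).
have PS v : (forall B, (B < N)%N -> P B v) -> P N v -> forall B, (B < N.+1)%N -> P B v.
  by move=> Q1 P1 B; rewrite ltnS leq_eqVlt => /predU1P[->|/Q1].
split.
  move=> v w Hv.
  have [g1 g10 H1] := Qopen v w (fun B BN => Hv B (ltnW BN)).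
  have [g2 g20 H2] := Popen N (ltnSn N) v w (Hv N (ltnSn N)).
  exists (g1 * g2); first by rewrite mulf_neq0.
  by move=> t; rewrite hornerM mulf_eq0 negb_or => /andP[/H1 ? /H2 ?]; apply: PS.
have [g1 g10 H1] := Qopen v0 (fun p i l => v1 p i l - v0 p i l) Qv0.
have [g2 g20 H2] := Popen N (ltnSn N) v1 (fun p i l => v0 p i l - v1 p i l) Pv1.
have [|t] := @poly_nonroot _ (g1 * (g2 \Po (1 - 'X))).
  rewrite mulf_neq0 //; have [s gs] := poly_nonroot g20.
  suff : (g2 \Po (1 - 'X)).[1 - s] != 0 by apply: contraNneq => ->; rewrite horner0.
  by rewrite horner_comp !hornerE opprB addrC subrK.
rewrite hornerM horner_comp !hornerE mulf_eq0 negb_or => /andP[/H1 G1 /H2 G2].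
eexists; apply: PS G1 _; move: G2; congr (P N _).
by apply: funext => p; apply: funext => i; apply: funext => l; ring.
Qed.

Lemma direct_open (T : finType) (q : nat) (a : nat -> nat) (D : T -> nat -> nat -> bool) :
  open_along_lines (direct q a D).
Proof.
move=> v w /direct_row_free Hv.
pose M := direction_matrix q a D (fun p i l => (v p i l)%:P + 'X * (w p i l)%:P).
have ME t : map_mx (horner_eval t) M
    = direction_matrix q a D (fun p i l => v p i l + t * w p i l).
  apply/matrixP => i j; rewrite !mxE; case: (enum_val i) => [p|[p [k l]]] /=.
    rewrite rmorph_prod; apply: eq_bigr => x _.
    by rewrite /= /horner_eval !hornerE.
  rewrite rmorphM /= rmorph_nat rmorph_prod; congr (_ * _); apply: eq_bigr => x _.
  by rewrite /= /horner_eval !hornerE.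
have [|g g0 Hg] := @row_free_open _ _ _ M 0.
  rewrite ME; suff <- : v = (fun p i l => v p i l + 0 * w p i l) by [].
  by apply: funext => p; apply: funext => i; apply: funext => l; rewrite mul0r addr0.
by exists g => // t /Hg; rewrite ME => /direct_row_free.
Qed.

(** Covers permuting the points, discarding some of them, and allowing fewer
  directions. *)
Lemma direct_relabel (T T' : finType) (f : T' -> T) (q : nat) (a : nat -> nat)
    (D : T -> nat -> nat -> bool) (D' : T' -> nat -> nat -> bool)
    (v : T -> nat -> nat -> C) :
  injective f -> (forall p i l, D' p i l -> D (f p) i l) ->
  direct q a D v -> direct q a D' (fun p => v (f p)).
Proof.
move=> f_inj DD' Hd lam tau tauP Hr.
pose lam' p := if [pick p' | f p' == p] is Some p' then lam p' else 0.
pose tau' p i l := if [pick p' | f p' == p] is Some p' then tau p' i l else 0.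
have pickf p : [pick p' | f p' == f p] = Some p.
  by case: pickP => [p' /eqP/f_inj -> //|/(_ p)]; rewrite eqxx.
have supp p i l : ~~ D p i l -> tau' p i l = 0.
  rewrite /tau'; case: pickP => // p' /eqP <- nD.
  by apply: tauP; apply: contra nD; apply: DD'.
have rel J : in_box q a J ->
    \sum_p tangent_coord q (lam' p) (v p) (tau' p) J = 0.
  move=> HJ; rewrite -[RHS](Hr J HJ).
  rewrite (bigID (fun p => p \in f @: T')) /= addrC big1 ?add0r; last first.
    move=> p pf; rewrite tangent_coord_notau /lam' /tau'.
      case: pickP => [p' /eqP fp|_]; last by rewrite mul0r.
      by rewrite -fp imset_f in pf.
    by move=> i _; case: pickP => [p' /eqP fp|//]; rewrite -fp imset_f in pf.
  rewrite big_imset /=; last by move=> x y _ _; apply: f_inj.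
  apply: eq_big => // p _; rewrite /lam' pickf.
  by apply: eq_tangent_coord => // i _; rewrite /tau' pickf.
move=> p; have [lam0 tau0] := Hd _ _ supp rel (f p).
split; first by rewrite -lam0 /lam' pickf.
by move=> i l iq la; rewrite -(tau0 i l iq la) /tau' pickf.
Qed.

Definition count_dirs (T : finType) (q : nat) (a : nat -> nat)
    (D : T -> nat -> nat -> bool) : nat :=
  (#|T| + \sum_(p : T) \sum_(i < q) \sum_(l < (a i).+1) D p i l)%N.

Lemma card_allowed (T : finType) (q : nat) (a : nat -> nat) (D : T -> nat -> nat -> bool) :
  #|allowed q a D| = count_dirs q a D.
Proof.
rewrite -sum1_card big_mkcond big_sumType /=; congr (_ + _)%N; first by rewrite sum1_card.
rewrite (eq_bigr (fun x => allowed q a D (inr x) : nat)); last first.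
  by move=> x _; rewrite -topredE /=; case: (allowed q a D (inr x)).
under [RHS]eq_bigr => p _.
  under eq_bigr => i _ do rewrite (big_ord_widen_cond _ predT (fun l => D p i l : nat)
     (leq_bigmax (F := fun i : 'I_q => a i) i : (a i < (\max_(i < q) a i).+1)%N)) big_mkcond.
  rewrite pair_bigA.
  over.
rewrite pair_bigA; apply: eq_bigr => -[p [i l]] _ /=.
by rewrite ltnS andbC; case: leqP.
Qed.

Definition extend_dirs (T U : finType) (D : T -> nat -> nat -> bool) :
  (T + U)%type -> nat -> nat -> bool := fun p => if p is inl p' then D p' else fun _ _ => false.

Definition extend_fun (T U V : Type) (v : T -> V) (x : U -> V) : (T + U)%type -> V :=
  fun p => match p with inl p' => v p' | inr u => x u end.

Lemma count_extend_dirs (T U : finType) (q : nat) (a : nat -> nat)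
    (D : T -> nat -> nat -> bool) :
  count_dirs q a (@extend_dirs T U D) = (count_dirs q a D + #|U|)%N.
Proof.
rewrite /count_dirs card_sum big_sumType /= [X in (_ + X)%N]addnC big1 ?add0n.
  by rewrite addnAC.
by move=> u _; apply: big1 => i _; apply: big1.
Qed.

(** The coordinate tensors span the whole space, so one of them lies outside the
  span of the given family as long as that span is not everything. *)
Lemma direct_add_point (T : finType) (q : nat) (a : nat -> nat) (D : T -> nat -> nat -> bool)
    (v : T -> nat -> nat -> C) :
  direct q a D v -> (count_dirs q a D < \prod_(i < q) (a i).+1)%N ->
  exists x, direct q a (@extend_dirs T unit D) (extend_fun v (fun=> x)).
Proof.
move=> Hd; rewrite -card_allowed => lt_count.
have /direct_row_free Mf := Hd; set M := direction_matrix _ _ _ _ in Mf.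
have card_box : #|box q a| = (\prod_(i < q) (a i).+1)%N.
  rewrite card_dep_ffun foldrE big_map big_enum /=.
  by apply: eq_bigr => i _; rewrite card_ord.
have /row_subPn[j nj] : ~~ (1%:M <= M)%MS.
  rewrite sub1mx /row_full; apply/negP => /eqP rM.
  by have := rank_leq_row M; rewrite rM card_box leqNgt lt_count.
pose J0 := enum_val j; exists (fun i l => (l == box_fun J0 i)%:R) => lam tau tauP Hr.
have x_coord (J : box q a) :
    segre_coord q (fun i l => (l == box_fun J0 i)%:R : C) (box_fun J) = (J == J0)%:R.
  have [->|JJ0] := eqVneq J J0; first by apply: big1 => i _; rewrite eqxx.
  have [i Ji] : exists i, J i != J0 i.
    apply/existsP; apply: contraNT JJ0 => /existsPn H.
    by apply/eqP/ffunP => i; apply/eqP/negPn/H.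
  rewrite /segre_coord (bigD1 i) //= !box_funE.
  suff -> : (J i == J0 i :> nat) = false by rewrite mul0r.
  by apply/negbTE; apply: contra Ji => /eqP E; apply/eqP/val_inj.
have split_sum J : \sum_p tangent_coord q (lam p)
      (extend_fun v (fun=> fun i l => (l == box_fun J0 i)%:R) p) (tau p) J
  = \sum_p tangent_coord q (lam (inl p)) (v p) (tau (inl p)) J
    + lam (inr tt) * segre_coord q (fun i l => (l == box_fun J0 i)%:R) J.
  rewrite big_sumType /= (big_pred1 tt); last by case.
  by rewrite tangent_coord_notau // => i _; apply: tauP.
have lam0 : lam (inr tt) = 0.
  apply: contraNeq nj => lam0.
  pose c (x : direction T q a) : C := match x with
    | inl p => lam (inl p)
    | inr (p, (i, l)) => if (l <= a i)%N then tau (inl p) i l else 0 end.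
  have cP x : ~~ allowed q a D x -> c x = 0.
    by case: x => [//|[p [i l]]] /=; case: leqP => _; rewrite ?andbT // => /(tauP (inl p)).
  apply/submxP; exists (- (lam (inr tt))^-1 *: \row_k c (enum_val k)).
  apply/rowP => k; rewrite -scalemxAl !mxE.
  have [J Jk] : exists J, k = enum_rank J by exists (enum_val k); rewrite enum_valK.
  have := split_sum (box_fun J); rewrite Hr; last exact: box_fun_in_box.
  rewrite -(@sum_direction_vector _ _ _ _ v c _ _ _ (box_fun_in_box J)) //; last first.
    by move=> p i l /= ->.
  rewrite x_coord (bigID (allowed q a D)) /= [X in _ + X + _]big1 ?addr0; last first.
    by move=> x /cP ->; rewrite mul0r.
  rewrite big_enum_val => E.
  have -> : (j == k) = (J == J0).
    by rewrite Jk /J0 -(inj_eq enum_val_inj) enum_rankK eq_sym.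
  rewrite (eq_bigr (fun i =>
      c (enum_val i) * direction_vector v (enum_val i) (box_fun J))); last first.
    by move=> i _; rewrite /M /direction_matrix !mxE Jk enum_rankK.
  move/esym/eqP: E; rewrite addr_eq0 => /eqP ->.
  by rewrite mulrNN mulrA mulVf // mul1r.
have Hr' J : in_box q a J ->
    \sum_p tangent_coord q (lam (inl p)) (v p) (tau (inl p)) J = 0.
  by move=> HJ; have := split_sum J; rewrite Hr // lam0 mul0r addr0.
have Hd' := Hd _ _ (fun p => tauP (inl p)) Hr'.
case=> [p|[]]; first exact: Hd'.
by split=> // i l _ _; apply: tauP.
Qed.

Lemma direct_add_points (T : finType) (q : nat) (a : nat -> nat) (D : T -> nat -> nat -> bool)
    (v : T -> nat -> nat -> C) t :
  direct q a D v -> (count_dirs q a D + t <= \prod_(i < q) (a i).+1)%N ->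
  exists x, direct q a (@extend_dirs T 'I_t D) (extend_fun v x).
Proof.
move=> Hd; elim: t => [_|t IHt lt_count].
  exists (fun=> fun _ _ => 0).
  pose f (p : (T + 'I_0)%type) : T := match p with
    | inl p' => p' | inr (Ordinal k k0) => False_rect T (notF k0) end.
  have f_inj : injective f by move=> [p|[]//] [p'|[]//] /= ->.
  have -> : extend_fun v (fun=> fun _ _ => 0) = fun p => v (f p) by apply: funext => -[p|[]].
  by apply: direct_relabel f_inj _ Hd => -[p|[]].
have [|x Hx] := IHt; first by lia.
have [|y Hy] := direct_add_point Hx.
  by rewrite count_extend_dirs card_ord; lia.
pose f (p : (T + 'I_t.+1)%type) : (T + 'I_t + unit)%type := match p with
  | inl p' => inl (inl p')
  | inr i => if unlift ord_max i is Some j then inl (inr j) else inr tt end.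
have f_inj : injective f.
  move=> [p|i] [p'|i'] //=; [by move=> [->] | by case: unliftP | by case: unliftP |].
  by case: unliftP => [j|] ->; case: unliftP => [j'|] -> // [->].
exists (fun i => extend_fun (extend_fun v x) (fun=> y) (f (inr i))).
have -> : extend_fun v (fun i => extend_fun (extend_fun v x) (fun=> y) (f (inr i)))
  = fun p => extend_fun (extend_fun v x) (fun=> y) (f p) by apply: funext => -[].
by apply: direct_relabel f_inj _ Hy => -[].
Qed.

End Genericity.

(** * Cutting the last factor into blocks *)

(** The last of the q + 1 factors has index q.  Its coordinates are cut into blocks of
  w consecutive ones (the last block may be shorter), and the last component
  of p is supported in the block beta p. *)
Section Splitting.
Variables (C : numFieldType) (T : finType) (q w : nat) (a : nat -> nat).
Variables (beta : T -> nat).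

Definition block_dims (B i : nat) : nat :=
  if i == q then minn w.-1 (a q - B * w) else a i.

(** Inside block B, a point of another block contributes x' (x) (the block): the
  coordinate 0 of the block is represented by the tensor with last component
  delta_0, the other ones by the directions of the last factor. *)
Definition block_dirs (piv : T -> nat -> nat) (B : nat) (p : T) (i l : nat) : bool :=
  if i == q then l != 0%N else (beta p == B) && (l != piv p i).

Definition block_fun (v : T -> nat -> nat -> C) (B : nat) (p : T) (i l : nat) : C :=
  if i == q then if beta p == B then v p q l else (l == 0%N)%:R else v p i l.

Definition split_piv (piv : T -> nat -> nat) (p : T) (i : nat) : nat :=
  if i == q then (beta p * w)%N else piv p i.

Definition split_fun (v : T -> nat -> nat -> C) (p : T) (i l : nat) : C :=
  if i == q then if (l %/ w)%N == beta p then v p q (l %% w)%N else 0 else v p i l.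

(** The slice of a relation over one block of coordinates of the last factor is
  a relation in which the points of that block keep their tangent vectors, while
  every other point x keeps only the directions x' (x) (the block), because its last
  component vanishes on that block. *)
Lemma direct_split piv v :
  (0 < w)%N -> (forall p, (beta p <= a q %/ w)%N) ->
  (forall B, (B <= a q %/ w)%N ->
    direct q.+1 (block_dims B) (block_dirs piv B) (block_fun v B)) ->
  direct q.+1 a (fun p i l => l != split_piv piv p i) (split_fun v).
Proof.
move=> w0 Hbeta Hblock lam tau tauP Hr.
have tau_piv p i : tau p i (split_piv piv p i) = 0 by apply: tauP; rewrite negbK.
have block_small B : (B <= a q %/ w)%N -> (B * w <= a q)%N by rewrite leq_divRL.
pose lamB B p := if beta p == B then lam p else tau p q (B * w)%N.
pose tauB B p i l := if i == q then (if l == 0%N then 0 else tau p q (B * w + l)%N)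
  else if beta p == B then tau p i l else 0.
have suppB B p i l : ~~ block_dirs piv B p i l -> tauB B p i l = 0.
  rewrite /block_dirs /tauB; case: eqP => [_|iq]; first by rewrite negbK => ->.
  case: eqP => //= _; rewrite negbK => /eqP ->.
  by have := tau_piv p i; rewrite /split_piv; case: eqP.
have relB B J : (B <= a q %/ w)%N -> in_box q.+1 (block_dims B) J ->
    \sum_p tangent_coord q.+1 (lamB B p) (block_fun v B p) (tauB B p) J = 0.
  move=> HB HJ; have Bq := block_small B HB.
  have : (J q <= minn w.-1 (a q - B * w))%N.
    by have := HJ q (ltnSn q); rewrite /block_dims eqxx.
  rewrite leq_min => /andP[Jw Jq].
  have {}Jw : (J q < w)%N by lia.
  pose J' i := if i == q then (B * w + J q)%N else J i.
  have J'box : in_box q.+1 a J'.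
    move=> i iq; rewrite /J'; case: eqP => [->|/eqP niq]; first by lia.
    by have := HJ i iq; rewrite /block_dims (negPf niq).
  rewrite -[RHS](Hr J' J'box); apply: eq_bigr => p _.
  have lt_neq i : (i < q)%N -> (i == q) = false by move=> iq; rewrite ltn_eqF.
  have XE : segre_coord q (block_fun v B p) J = segre_coord q (split_fun v p) J'.
    by apply: eq_segre_coord => i /lt_neq iq; rewrite /block_fun /split_fun /J' iq.
  have divE : ((B * w + J q) %/ w)%N = B by rewrite divnMDl // divn_small // addn0.
  have modE : ((B * w + J q) %% w)%N = J q by rewrite modnMDl modn_small.
  rewrite !tangent_coordS XE [split_fun v p q _]/split_fun [J' q]/J' eqxx divE modE.
  rewrite [block_fun v B p q _]/block_fun [tauB B p q _]/tauB eqxx [B == _]eq_sym.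
  have [E|nE] := eqVneq (beta p) B.
    congr (_ * _ + _ * _); last first.
      case: eqP => [J0|//]; rewrite J0 addn0.
      by have := tau_piv p q; rewrite /split_piv eqxx E => ->.
    rewrite /lamB E eqxx; apply: eq_tangent_coord => i /lt_neq iq.
      by rewrite /block_fun /split_fun /J' iq.
    by rewrite /tauB /J' iq E eqxx.
  rewrite mulr0 add0r tangent_coord_notau; last first.
    by move=> i /lt_neq iq; rewrite /tauB iq (negPf nE).
  rewrite XE /lamB (negPf nE); case: eqP => [->|_].
    by rewrite addn0 mulr1 mulr0 addr0 mulrC.
  by rewrite mulr0 add0r.
have zero B p : (B <= a q %/ w)%N -> lamB B p = 0 /\
    forall i l, (i < q.+1)%N -> (l <= block_dims B i)%N -> tauB B p i l = 0.
  by move=> HB; apply: (Hblock B HB) (suppB B) (fun J => relB B J HB) p.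
move=> p; split.
  by have [] := zero _ p (Hbeta p); rewrite /lamB eqxx.
move=> i l; rewrite ltnS leq_eqVlt => /predU1P[-> lq|iq la]; last first.
  have [_ /(_ i l (leqW iq))] := zero _ p (Hbeta p).
  by rewrite /block_dims /tauB ltn_eqF // eqxx; apply.
have HB : (l %/ w <= a q %/ w)%N by apply: leq_div2r.
have [lam0 tau0] := zero _ p HB.
have lE := divn_eq l w.
have [l0|l0] := eqVneq (l %% w)%N 0%N; last first.
  have := tau0 q (l %% w)%N (ltnSn q); rewrite /block_dims /tauB eqxx (negPf l0) -lE; apply.
  have := ltn_pmod l w0; rewrite leq_min; lia.
rewrite lE l0 addn0; have [E|nE] := eqVneq (beta p) (l %/ w)%N.
  by have := tau_piv p q; rewrite /split_piv eqxx E.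
by move: lam0; rewrite /lamB (negPf nE).
Qed.

(** The conditions on the blocks are open, so a generic configuration satisfies all of
  them at once, even if each was checked on a configuration of its own. *)
Lemma direct_split_generic :
  (0 < w)%N -> (forall p, (beta p <= a q %/ w)%N) ->
  (forall B, (B <= a q %/ w)%N -> exists piv v,
    (forall p i, (i < q)%N -> (piv p i <= a i)%N) /\
    direct q.+1 (block_dims B) (block_dirs piv B) (block_fun v B)) ->
  exists piv (v : T -> nat -> nat -> C),
    (forall p i, (i < q.+1)%N -> (piv p i <= a i)%N) /\
    direct q.+1 a (fun p i l => l != piv p i) v.
Proof.
move=> w0 Hbeta Hblock.
have /choice[pivs Hpivs] : forall B, exists piv, (B <= a q %/ w)%N -> exists v,
    (forall p i, (i < q)%N -> (piv p i <= a i)%N) /\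
    direct q.+1 (block_dims B) (block_dirs piv B) (block_fun v B).
  move=> B; have [/Hblock[piv Hp]|] := leqP B (a q %/ w); first by exists piv.
  by exists (fun _ _ => 0%N).
(* Only the block of p uses the pivots of p. *)
pose piv p := pivs (beta p) p.
have same_dirs B : block_dirs (pivs B) B = block_dirs piv B.
  apply: funext => p; apply: funext => i; apply: funext => l.
  rewrite /block_dirs /piv; case: ifP => // _.
  by case: eqP => [->|].
have [||v Hv] := @open_common _ T (fun B v =>
  direct q.+1 (block_dims B) (block_dirs piv B) (block_fun v B)) (a q %/ w).+1.
- move=> B _ v u Hd.
  have [g g0 Hg] := direct_open (fun p i l => if i == q then
     if beta p == B then u p q l else 0 else u p i l) Hd.
  exists g => // t /Hg; congr (direct _ _ _ _).
  apply: funext => p; apply: funext => i; apply: funext => l; rewrite /block_fun.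
  by case: eqP => // _; case: eqP => // _; rewrite mulr0 addr0.
- by move=> B; rewrite ltnS => HB; have [v [_]] := Hpivs B HB; rewrite same_dirs; exists v.
exists (split_piv piv), (split_fun v); split; last exact: direct_split.
move=> p i; rewrite ltnS leq_eqVlt /split_piv => /predU1P[->|iq].
  by rewrite eqxx -leq_divRL.
by rewrite ltn_eqF //; have [v' [+ _]] := Hpivs _ (Hbeta p); apply.
Qed.

End Splitting.

(** * Two-dimensional blocks: pencils of matrices *)

Lemma split_injection (T U V : finType) (S : {pred T}) :
  (#|S| <= #|U|)%N -> (#|[predC S]| <= #|V|)%N ->
  exists f : T -> (U + V)%type, injective f /\
    forall p, if f p is inl _ then p \in S else p \notin S.
Proof.
move=> SU SV.
have nS p : ~ (p \in S) -> p \in [predC S] by move/negP.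
pose f p : (U + V)%type := match @idP (p \in S) with
  | ReflectT h => inl (enum_val (widen_ord SU (enum_rank_in h p)))
  | ReflectF h => inr (enum_val (widen_ord SV (enum_rank_in (nS p h) p))) end.
exists f; split; last by move=> p; rewrite /f; case: {-}_ / idP => // /negP.
move=> p p'; rewrite /f; case: {-}_ / idP => h; case: {-}_ / idP => h' //.
  move=> [/enum_val_inj/(congr1 val)/= E].
  have {}E : enum_rank_in h p = enum_rank_in h' p' by apply: val_inj.
  by rewrite -(enum_rankK_in h h) E enum_rankK_in.
move=> [/enum_val_inj/(congr1 val)/= E].
have {}E : enum_rank_in (nS p h) p = enum_rank_in (nS p' h') p' by apply: val_inj.
by rewrite -(enum_rankK_in (nS p h) (nS p h)) E enum_rankK_in ?nS.
Qed.

(** Three factors, the last one of dimension 2.  The s tangent points are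
  e_i (x) e_i (x) (1, i).  Modulo their tangent spaces, the cell (i, j) of the first two
  factors retains nothing if i, j < s, both dimensions if s <= i, j, and one
  dimension otherwise.  The double points fill what remains, up to an unpaired index
  if s is odd, by planes y (x) C^2: y is a unit matrix when s <= i, j, and for s <= j it is (e_(2h) + e_(2h+1)) (x) e_j, which
  merges two cells with one dimension each, and symmetrically for s <= i. *)
Section PencilBlock.
Variables (C : numFieldType) (s : nat) (a : nat -> nat).
Hypotheses (s0 : (s <= (a 0).+1)%N) (s1 : (s <= (a 1).+1)%N) (a2 : a 2 = 1%N).

Definition double_point : finType :=
  ('I_((a 0).+1 - s) * 'I_((a 1).+1 - s) + ('I_(s./2) * 'I_((a 1).+1 - s)
   + 'I_((a 0).+1 - s) * 'I_(s./2)))%type.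

Definition block_point : finType := ('I_s + double_point)%type.

(** The rank one matrix of a double point is the indicator of a set of rows times the
  indicator of a set of columns. *)
Definition row_support (d : double_point) (l : nat) : bool :=
  match d with
  | inl (x, _) | inr (inr (x, _)) => l == (s + x)%N
  | inr (inl (h, _)) => l./2 == h
  end.

Definition col_support (d : double_point) (l : nat) : bool :=
  match d with
  | inl (_, y) | inr (inl (_, y)) => l == (s + y)%N
  | inr (inr (_, h)) => l./2 == h
  end.

Definition block_vector (p : block_point) (k l : nat) : C :=
  match p with
  | inl i => if k == 2%N then if l == 0%N then 1 else i%:R else (l == i)%:R
  | inr d => if k == 2%N then (l == 0%N)%:R
             else if k == 0%N then (row_support d l)%:R else (col_support d l)%:R
  end.

Definition block_allowed (p : block_point) (k l : nat) : bool :=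
  if k == 2%N then l != 0%N else if p is inl i then l != i else false.

Let coord3 i j c (k : nat) : nat := if k == 0%N then i else if k == 1%N then j else c.

Lemma sum_delta_ord (n x : nat) (F : 'I_n -> C) :
  \sum_(p < n) (x == p)%:R * F p = if insub x is Some p then F p else 0.
Proof.
case: insubP => [p _ <-|nx].
  rewrite (bigD1 p) //= eqxx mul1r big1 ?addr0 // => i.
  by rewrite eq_sym -val_eqE /= => /negPf ->; rewrite mul0r.
rewrite big1 // => i _; case: eqP => [E|_]; last by rewrite mul0r.
by rewrite E ltn_ord in nx.
Qed.

Lemma block_direct : direct 3 a block_allowed block_vector.
Proof.
move=> lam tau tauP Hr.
pose z (i c : nat) : C := if c == 0%N then 1 else i%:R.
pose om (d : double_point) c : C := lam (inr d) * (c == 0%N)%:R + tau (inr d) 2%N c.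
pose tg (F : 'I_s -> C) x := if insub x is Some p then F p else 0.
have tau20 p : tau p 2%N 0%N = 0 by apply: tauP.
have tau_piv (p : 'I_s) k : (k < 2)%N -> tau (inl p) k p = 0.
  by case: k => [|[|]] // _; apply: tauP; rewrite /block_allowed /= eqxx.
have taud (d : double_point) k l : (k < 2)%N -> tau (inr d) k l = 0.
  by case: k => [|[|]] // _; apply: tauP.
(* The slice of the relation in cell (i, j), a vector of the plane. *)
have cell i j c : (i <= a 0)%N -> (j <= a 1)%N -> (c <= 1)%N ->
    tg (fun p => (lam (inl p) * (i == p)%:R + tau (inl p) 0%N i) * z p c) j
    + tg (fun p => tau (inl p) 1%N j * z p c + (j == p)%:R * tau (inl p) 2%N c) i
    + \sum_d (row_support d i)%:R * (col_support d j)%:R * om d c = 0.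
  move=> ia ja c1; rewrite -[RHS](Hr (coord3 i j c)); last first.
    by case=> [|[|[|]]] // _; rewrite /coord3 /= a2.
  rewrite [RHS]big_sumType /= /tg -!sum_delta_ord -big_split /=; congr (_ + _).
    apply: eq_bigr => p _; rewrite !tangent_coordS !segre_coordS.
    rewrite /tangent_coord /segre_coord !big_ord0 /coord3 /= -/(z p c); ring.
  apply: eq_bigr => d _; rewrite !tangent_coordS !segre_coordS.
  rewrite /tangent_coord /segre_coord !big_ord0 /coord3 /=.
  by rewrite (taud d 0%N) // (taud d 1%N) // /om; ring.
have tg_in F (p : 'I_s) : tg F p = F p by rewrite /tg valK.
have tg_out F x : (s <= x)%N -> tg F x = 0 by move=> sx; rewrite /tg insubN // -leqNgt.
have inA (p : 'I_s) : (p <= a 0)%N by rewrite -ltnS (leq_trans (ltn_ord p)).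
have inB (p : 'I_s) : (p <= a 1)%N by rewrite -ltnS (leq_trans (ltn_ord p)).
have half_lt (h : 'I_(s./2)) x : x./2 = h -> (x < s)%N.
  by move=> E; have := ltn_ord h; rewrite -E; lia.
have inner (i j : 'I_s) c : (c <= 1)%N ->
    (lam (inl j) * (i == j)%:R + tau (inl j) 0%N i) * z j c
    + (tau (inl i) 1%N j * z i c + (j == i)%:R * tau (inl i) 2%N c) = 0.
  move=> c1; rewrite -[RHS](cell i j c (inA i) (inB j) c1) !tg_in big1 ?addr0 // => d _.
  suff : ~~ (row_support d i && col_support d j).
    by case: row_support; case: col_support => // _; rewrite ?mul0r ?mulr0 ?mul0r.
  have := ltn_ord i; have := ltn_ord j.
  by case: d => [[x y]|[[h y]|[x h]]] /=; lia.
have lam0 (i : 'I_s) : lam (inl i) = 0.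
  have := inner i i 0%N isT; rewrite /z eqxx !tau_piv // tau20.
  by rewrite !(mulr1, mulr0, mul0r, addr0).
have tau21 (i : 'I_s) : tau (inl i) 2%N 1%N = 0.
  have := inner i i 1%N isT; rewrite /z eqxx !tau_piv // lam0.
  by rewrite !(mulr1, mul1r, mulr0, mul0r, addr0, add0r).
(* The cell (i, j) is spanned by the independent vectors (1, i) and (1, j). *)
have off_diag (i j : 'I_s) : i != j ->
    tau (inl j) 0%N i = 0 /\ tau (inl i) 1%N j = 0.
  move=> ij; have := inner i j 0%N isT; have := inner i j 1%N isT.
  have nij : (i == j) = false by apply/negbTE.
  have nji : (j == i) = false by rewrite eq_sym.
  rewrite /z /= nij nji !(mulr1, mulr0, mul0r, addr0, add0r).
  set t := tau (inl j) _ _; set t' := tau (inl i) _ _ => E1 E0.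
  have t'E : t' = - t by apply/eqP; rewrite -addr_eq0 addrC E0.
  have /eqP : t * (j%:R - i%:R) = 0 by rewrite -E1 t'E; ring.
  by rewrite mulf_eq0 subr_eq0 eqr_nat [(j : nat) == i]nji orbF t'E => /eqP ->; rewrite oppr0.
have support_uniq (d d' : double_point) i j : row_support d i -> col_support d j ->
    row_support d' i -> col_support d' j -> d = d'.
  case: d => [[x y]|[[h y]|[x h]]]; case: d' => [[x' y']|[[h' y']|[x' h']]] /=;
  move=> /eqP E1 /eqP E2 /eqP E3 /eqP E4;
  try by [have := half_lt _ _ E1; lia | have := half_lt _ _ E2; lia
         | have := half_lt _ _ E3; lia | have := half_lt _ _ E4; lia].
  - by congr (inl (_, _)); apply: val_inj => /=; lia.
  - by congr (inr (inl (_, _))); apply: val_inj => /=; lia.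
  - by congr (inr (inr (_, _))); apply: val_inj => /=; lia.
have sum1 (d : double_point) i j c : row_support d i -> col_support d j ->
    \sum_d (row_support d i)%:R * (col_support d j)%:R * om d c = om d c.
  move=> di dj; rewrite (bigD1 d) //= di dj !mul1r big1 ?addr0 // => d' d'd.
  suff : ~~ (row_support d' i && col_support d' j).
    by case: row_support; case: col_support => // _; rewrite ?mul0r ?mulr0 ?mul0r.
  by apply: contra d'd => /andP[d'i d'j]; apply/eqP; apply: support_uniq d'i d'j di dj.
have sum0 i j c : (forall d, ~~ (row_support d i && col_support d j)) ->
    \sum_d (row_support d i)%:R * (col_support d j)%:R * om d c = 0.
  move=> H; apply: big1 => d _; have := H d.
  by case: row_support; case: col_support => // _; rewrite ?mul0r ?mulr0 ?mul0r.
have rowB i j : (i <= a 0)%N -> (j <= a 1)%N -> (s <= i)%N -> (s <= j)%N ->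
    forall d c, (c <= 1)%N -> row_support d i -> col_support d j -> om d c = 0.
  move=> ia ja si sj d c c1 di dj.
  by have := cell i j c ia ja c1; rewrite !tg_out // !add0r (sum1 d).
(* The vectors (1, 2h) and (1, 2h+1) are independent, so a plane glued to both of
   their cells meets the span of the two only in 0. *)
have pair_zero (F : 'I_s -> C) (o : nat -> C) (h : 'I_(s./2)) :
    (forall (i : 'I_s) c, (c <= 1)%N -> i./2 = h -> F i * z i c + o c = 0) ->
    (forall c, (c <= 1)%N -> o c = 0) /\ (forall i : 'I_s, i./2 = h -> F i = 0).
  move=> H; have hs := ltn_ord h.
  have lt0 : (h.*2 < s)%N by lia.
  have lt1 : (h.*2.+1 < s)%N by lia.
  have h0 : (Ordinal lt0 : 'I_s)./2 = h by rewrite /= doubleK.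
  have h1 : (Ordinal lt1 : 'I_s)./2 = h by rewrite /= uphalf_double.
  have := H _ 1%N isT h1; have := H _ 1%N isT h0.
  have := H _ 0%N isT h1; have := H _ 0%N isT h0; rewrite /z /= !mulr1.
  set t := F _; set t' := F _ => e0 e1 e2 e3.
  have tt' : t' = t by apply: (addIr (o 0%N)); rewrite e0 e1.
  have t0 : t = 0 by move: e3; rewrite tt' -natr1 mulrDr mulr1 addrAC e2 add0r.
  have o0 : o 0%N = 0 by rewrite -e0 t0 add0r.
  split; first by case=> [|[|]] // _; rewrite -e2 t0 mul0r add0r.
  by move=> i /(H i 0%N isT); rewrite /z /= mulr1 o0 addr0.
have right_cell (i : 'I_s) j c : (s <= j)%N -> (j <= a 1)%N -> (c <= 1)%N ->
    tau (inl i) 1%N j * z i c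
    + \sum_d (row_support d i)%:R * (col_support d j)%:R * om d c = 0.
  move=> sj ja c1; have := cell i j c (inA i) ja c1; rewrite tg_out // add0r tg_in.
  have -> : (j == i) = false by apply/eqP => E; have := ltn_ord i; lia.
  by rewrite mul0r addr0.
have lower_cell i (j : 'I_s) c : (s <= i)%N -> (i <= a 0)%N -> (c <= 1)%N ->
    tau (inl j) 0%N i * z j c
    + \sum_d (row_support d i)%:R * (col_support d j)%:R * om d c = 0.
  move=> si ia c1; have := cell i j c ia (inB j) c1; rewrite tg_in (tg_out _ i) // addr0.
  have -> : (i == j) = false by apply/eqP => E; have := ltn_ord j; lia.
  by rewrite mulr0 add0r.
have right_zero (i : 'I_s) j : (s <= j)%N -> (j <= a 1)%N -> tau (inl i) 1%N j = 0.
  move=> sj ja; have [ih|ih] := ltnP i./2 s./2.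
    have jy : (j - s < (a 1).+1 - s)%N by lia.
    pose d : double_point := inr (inl (Ordinal ih, Ordinal jy)).
    have cells (i' : 'I_s) c : (c <= 1)%N -> i'./2 = Ordinal ih ->
        tau (inl i') 1%N j * z i' c + om d c = 0.
      move=> c1 i'h; rewrite -[RHS](right_cell i' j c sj ja c1) (sum1 d) //=.
        by rewrite i'h.
      by rewrite subnKC.
    by have [_ ->] := pair_zero (fun i => tau (inl i) 1%N j) _ _ cells.
  have := right_cell i j 0%N sj ja isT; rewrite sum0 /z /= ?mulr1 ?addr0 // => d.
  have := ltn_ord i; case: d => [[x y]|[[h y]|[x h]]] /=; try lia.
  by have := ltn_ord h; lia.
have lower_zero i (j : 'I_s) : (s <= i)%N -> (i <= a 0)%N -> tau (inl j) 0%N i = 0.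
  move=> si ia; have [jh|jh] := ltnP j./2 s./2.
    have ix : (i - s < (a 0).+1 - s)%N by lia.
    pose d : double_point := inr (inr (Ordinal ix, Ordinal jh)).
    have cells (j' : 'I_s) c : (c <= 1)%N -> j'./2 = Ordinal jh ->
        tau (inl j') 0%N i * z j' c + om d c = 0.
      move=> c1 j'h; rewrite -[RHS](lower_cell i j' c si ia c1) (sum1 d) //=.
        by rewrite subnKC.
      by rewrite j'h.
    by have [_ ->] := pair_zero (fun j => tau (inl j) 0%N i) _ _ cells.
  have := lower_cell i j 0%N si ia isT; rewrite sum0 /z /= ?mulr1 ?addr0 // => d.
  have := ltn_ord j; case: d => [[x y]|[[h y]|[x h]]] /=; try lia.
  by have := ltn_ord h; lia.
have om0 (d : double_point) c : (c <= 1)%N -> om d c = 0.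
  move=> c1; case: d => [[x y]|[[h y]|[x h]]].
  - have := ltn_ord x; have := ltn_ord y => ys xs.
    by apply: (rowB (s + x)%N (s + y)%N) => //=; lia.
  - have hs := ltn_ord h; have ys := ltn_ord y.
    have lt0 : (h.*2 < s)%N by lia.
    have ja : (s + y <= a 1)%N by lia.
    have := right_cell (Ordinal lt0) (s + y)%N c (leq_addr _ _) ja c1.
    by rewrite right_zero ?leq_addr // mul0r add0r (sum1 (inr (inl (h, y)))) //= doubleK.
  - have hs := ltn_ord h; have xs := ltn_ord x.
    have lt0 : (h.*2 < s)%N by lia.
    have ia : (s + x <= a 0)%N by lia.
    have := lower_cell (s + x)%N (Ordinal lt0) c (leq_addr _ _) ia c1.
    by rewrite lower_zero ?leq_addr // mul0r add0r (sum1 (inr (inr (x, h)))) //= doubleK.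
case=> [i|d]; last first.
  have lam_d : lam (inr d) = 0 by have := om0 d 0%N isT; rewrite /om eqxx mulr1 tau20 addr0.
  split=> // -[|[|[|]]] // l _; [by rewrite taud | by rewrite taud | rewrite a2].
  case: l => [|[|]] // _.
  by have := om0 d 1%N isT; rewrite /om mulr0 add0r.
split; first exact: lam0.
case=> [|[|[|]]] // l _.
- move=> la; have [ls|sl] := ltnP l s; last exact: lower_zero.
  have [E|ne] := eqVneq (Ordinal ls) i; first by rewrite -E (tau_piv (Ordinal ls)).
  by have [->] := off_diag _ _ ne.
- move=> la; have [ls|sl] := ltnP l s; last exact: right_zero.
  have [E|ne] := eqVneq i (Ordinal ls); first by rewrite E (tau_piv (Ordinal ls)).
  by have [_ ->] := off_diag _ _ ne.
by rewrite a2; case: l => [|[|]] // _; rewrite ?tau20 ?tau21.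
Qed.

End PencilBlock.

(** * From q to q + 1 factors *)

(** Division by b is injective on a residue class modulo b. *)
Lemma card_residue_le k e b B : (0 < b)%N ->
  (#|[pred p : 'I_k | (e <= p)%N && ((p - e) %% b == B)%N]| <= ((k - e).-1 %/ b).+1)%N.
Proof.
move=> b0; set S := [pred p | _]; set m := _.+1.
pose f (p : 'I_k) : 'I_m := inord ((p - e) %/ b).
have fE p : p \in S -> f p = ((p - e) %/ b)%N :> nat.
  move=> /andP[ep _]; rewrite inordK // ltnS leq_div2r //.
  by have := ltn_ord p; lia.
have f_inj : {in S &, injective f}.
  move=> p p' pS p'S /(congr1 val) /=; rewrite !fE // => E.
  move: pS p'S => /andP[ep /eqP rp] /andP[ep' /eqP rp']; apply: val_inj => /=.
  have Epp : (p - e = p' - e)%N by rewrite (divn_eq (p - e) b) E rp -{1}rp' -divn_eq.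
  by rewrite -(subnK ep) Epp subnK.
by rewrite -(card_in_imset f_inj) (leq_trans (max_card _)) // card_ord.
Qed.

Section Existence.
Variable C : numFieldType.
Implicit Types (q k : nat) (a : nat -> nat).

(** k points whose tangent spaces are independent, each of them of the maximal
  dimension 1 + sum a_i because the excluded pivot leaves a i directions in
  factor i. *)
Definition nondefective q a k : Prop :=
  exists piv (v : 'I_k -> nat -> nat -> C),
    (forall p i, (i < q)%N -> (piv p i <= a i)%N) /\
    direct q a (fun p i l => l != piv p i) v.

Lemma nondefective1 q a : nondefective q a 1.
Proof.
exists (fun _ _ => 0%N), (fun _ _ l => (l == 0%N)%:R); split=> // lam tau tauP Hr.
have tau0 p i : tau p i 0%N = 0 by apply: tauP.
have lam0 : lam ord0 = 0.
  have := Hr (fun=> 0%N) (fun _ _ => leq0n _); rewrite big_ord1 tangent_coord_notau //.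
  by rewrite /segre_coord big1 ?mulr1.
move=> p; rewrite (ord1 p) lam0; split=> // i l iq la.
have [->//|l0] := eqVneq l 0%N.
pose J j := if j == i then l else 0%N.
have := Hr J; rewrite big_ord1 /tangent_coord lam0 mul0r add0r (bigD1 (Ordinal iq)) //=.
rewrite big1 ?addr0 => [H|j /negPf ji]; last first.
  by rewrite /J (_ : (j == i :> nat) = false) ?tau0 ?mul0r // -ji.
rewrite /J eqxx /segre_cofactor big1 ?mulr1 in H.
  by apply: H => j jq; rewrite /J; case: eqP => [->|].
by move=> j /negPf ->.
Qed.

Lemma sum_neq_le m piv : (piv <= m)%N -> (\sum_(l < m.+1) (l != piv :> nat) = m)%N.
Proof.
move=> pm; rewrite (bigD1 (Ordinal (pm : (piv < m.+1)%N))) //= eqxx add0n.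
rewrite (eq_bigr (fun=> 1%N)) => [|l lp]; last by rewrite (_ : (l != piv :> nat) = true).
by rewrite sum1_card (eq_card (B := predC1 (Ordinal (pm : (piv < m.+1)%N)))) ?cardC1 ?card_ord.
Qed.

Lemma direct_tangents_points q a s (T : finType) (S : {pred T}) :
  nondefective q a s -> (#|S| <= s)%N ->
  (#|S| * (\sum_(i < q) a i) + #|T| <= \prod_(i < q) (a i).+1)%N ->
  exists piv (v : T -> nat -> nat -> C),
    (forall p i, (i < q)%N -> (piv p i <= a i)%N) /\
    direct q a (fun p i l => (p \in S) && (l != piv p i)) v.
Proof.
move=> [piv [v [piv_a Hv]]] Ss count.
pose U : finType := 'I_#|S|; pose pivU (u : U) := piv (widen_ord Ss u).
have HU : direct q a (fun u i l => l != pivU u i) (fun u => v (widen_ord Ss u)).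
  by apply: direct_relabel _ Hv => // u u' /(congr1 val) /= E; apply: val_inj.
have cardT := cardC S; have [|x Hx] := direct_add_points (t := #|[predC S]|) HU.
  rewrite /count_dirs card_ord (eq_bigr (fun=> \sum_(i < q) a i)%N); last first.
    by move=> u _; apply: eq_bigr => i _; apply/sum_neq_le/piv_a.
  by rewrite sum_nat_const card_ord addnAC cardT addnC.
have [||f [f_inj fS]] := @split_injection T U 'I_#|[predC S]| S; rewrite ?card_ord //.
exists (fun p i => if f p is inl u then pivU u i else 0%N),
  (fun p => extend_fun (fun u => v (widen_ord Ss u)) x (f p)).
split; first by move=> p i iq; case: (f p) => // u; apply: piv_a.
apply: direct_relabel f_inj _ Hx => p i l /andP[pS]; have := fS p.
by case: (f p) => //= _; rewrite pS.
Qed.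

(** A factor of dimension 1 changes nothing; this interprets configurations with q
  factors as one-dimensional blocks of the last of q + 1 factors. *)
Lemma direct_lift (T : finType) q (beta : T -> nat) a a' piv B (v : T -> nat -> nat -> C) :
  (forall i, (i < q)%N -> a' i = a i) -> a' q = 0%N ->
  direct q a (fun p i l => (beta p == B) && (l != piv p i)) v ->
  direct q.+1 a' (block_dirs q beta piv B)
    (block_fun q beta (fun p i l => if i == q then 1 else v p i l) B).
Proof.
move=> aa' a'q Hd lam tau tauP Hr.
have lt_neq i : (i < q)%N -> (i == q) = false by move=> iq; rewrite ltn_eqF.
have tauq p : tau p q 0%N = 0 by apply: tauP; rewrite /block_dirs eqxx.
pose tau' p i l := if i == q then 0 else tau p i l.
have supp p i l : ~~ ((beta p == B) && (l != piv p i)) -> tau' p i l = 0.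
  by move=> H; rewrite /tau'; case: eqP => // /eqP iq; apply: tauP; rewrite /block_dirs (negPf iq).
have rel J : in_box q a J -> \sum_p tangent_coord q (lam p) (v p) (tau' p) J = 0.
  move=> HJ; pose J' i := if i == q then 0%N else J i.
  rewrite -[RHS](Hr J'); last first.
    move=> i; rewrite ltnS leq_eqVlt /J' => /predU1P[->|iq]; first by rewrite eqxx.
    by rewrite lt_neq // aa' // HJ.
  apply: eq_bigr => p _; rewrite tangent_coordS /J' eqxx tauq mulr0 addr0.
  rewrite {2}/block_fun eqxx if_same mulr1.
  by apply: eq_tangent_coord => i /lt_neq iq; rewrite /block_fun /tau' iq.
move=> p; have [lam0 tau0] := Hd _ _ supp rel p; split=> // i l.
rewrite ltnS leq_eqVlt => /predU1P[->|iq]; first by rewrite a'q leqn0 => /eqP ->.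
by rewrite aa' // => la; have := tau0 i l iq la; rewrite /tau' lt_neq.
Qed.

(** One-dimensional blocks, with the points distributed evenly among them: a block has
  tangent spaces at its own points and simple points elsewhere. *)
Lemma nondefective_step q a k :
  nondefective q a (k.-1 %/ (a q).+1).+1 ->
  ((k.-1 %/ (a q).+1).+1 * (\sum_(i < q) a i) + k <= \prod_(i < q) (a i).+1)%N ->
  nondefective q.+1 a k.
Proof.
move=> Hs count; pose beta (p : 'I_k) := (p %% (a q).+1)%N.
apply: (@direct_split_generic _ _ q 1 a beta) => //.
  by move=> p; rewrite divn1 -ltnS ltn_pmod.
move=> B _; pose S := [pred p : 'I_k | beta p == B].
have cardS : (#|S| <= (k.-1 %/ (a q).+1).+1)%N.
  have := @card_residue_le k 0 (a q).+1 B isT; rewrite subn0; apply: leq_trans.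
  by apply: subset_leq_card; apply/fintype.subsetP => p; rewrite !inE subn0.
have [|piv [v [piv_a Hv]]] := direct_tangents_points Hs cardS.
  by rewrite card_ord; apply: leq_trans count; rewrite leq_add2r leq_mul2r cardS orbT.
exists piv, (fun p i l => if i == q then 1 else v p i l); split=> //.
apply: direct_lift Hv => [i iq|]; first by rewrite /block_dims ltn_eqF.
by rewrite /block_dims eqxx /= min0n.
Qed.

Lemma direct_pencil_block (T : finType) (S : {pred T}) a :
  a 2 = 1%N -> (#|S| <= (a 0).+1)%N -> (#|S| <= (a 1).+1)%N ->
  (#|[predC S]| <= #|double_point #|S| a|)%N ->
  exists piv (v : T -> nat -> nat -> C),
    (forall p i, (i < 2)%N -> (piv p i <= a i)%N) /\
    direct 3 a (fun p i l => if i == 2 then l != 0%N else (p \in S) && (l != piv p i))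
      (fun p i l => if i == 2 then if p \in S then v p 2 l else (l == 0%N)%:R else v p i l).
Proof.
move=> a2 S0 S1 count; have Hd := @block_direct C _ _ S0 S1 a2.
have [||f [f_inj fS]] := @split_injection T 'I_#|S| (double_point #|S| a) S;
  rewrite ?card_ord //.
exists (fun p i => if f p is inl u then u : nat else 0%N),
  (fun p => block_vector C (f p)); split.
  by move=> p [|[|]] // _; case: (f p) => // u; rewrite -ltnS; apply: leq_trans (ltn_ord u) _.
have -> : (fun p i l => if i == 2 then
      if p \in S then block_vector C (f p) 2 l else (l == 0%N)%:R
    else block_vector C (f p) i l) = (fun p => block_vector C (f p)).
  apply: funext => p; apply: funext => i; apply: funext => l; have := fS p.
  by case: eqP => // ->; case: (f p) => [u ->|d /negPf ->].
apply: direct_relabel f_inj _ Hd => p i l; rewrite /block_allowed; case: eqP => // _.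
by have := fS p; case: (f p) => [u _ /andP[]|d /negPf ->].
Qed.

End Existence.

(** * Counting points in the three-factor case *)

(** Here n_3 = 2 b + e with e <= 1; k - e points are shared evenly by b blocks of
  dimension 2, so that y + 1 bounds their number in a block, and if e = 1 one more
  point goes to a block of dimension 1. *)
Section Arithmetic.
Variables (a0 a1 a2 k e b y c : nat).
Hypotheses (cE : (a0 * a1 = c + a2)%N) (c0 : (0 < c)%N).
Hypotheses (a02 : (a0 <= a2)%N) (a12 : (a1 <= a2)%N).
Hypothesis kD : (k.-1 * (1 + a0 + a1 + a2) < c * a2.+1)%N.
Hypotheses (nE : (a2.+1 = b * 2 + e)%N) (e1 : (e <= 1)%N).
Hypothesis yb : (y * b <= (k - e).-1)%N.

(** Ensures that a block has room for y + 1 points e_i (x) e_i; here x and z are the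
  dimensions of the first two factors, in either order. *)
Lemma block_size_lt x z : (x * z = c + a2)%N -> (x <= a2)%N -> (z <= a2)%N ->
  (k.-1 * (1 + x + z + a2) < c * a2.+1)%N -> (y < x)%N.
Proof.
move=> xz xa za HK; rewrite ltnNge; apply/negP => xy.
have ya : (y * a2 <= 2 * k.-1)%N.
  have : (y * a2 <= y * (b * 2))%N by rewrite leq_mul2l; apply/orP; right; lia.
  lia.
have x0 : (0 < x)%N by case: x xz {HK xa xy} => //; lia.
have bound : (2 * (c * a2.+1) <= x * a2 * (1 + x + z + a2))%N.
  have h1 : (x * z * a2 <= x * a2 * a2)%N by rewrite leq_mul2r leq_mul2l za !orbT.
  have h2 : (x * z <= x * a2)%N by rewrite leq_mul2l za orbT.
  have h3 : (x * a2 <= x * x * a2)%N by rewrite leq_mul2r leq_pmulr ?orbT.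
  have h0 : (x * z * a2 = (c + a2) * a2)%N by rewrite xz.
  lia.
have h4 : (x * a2 <= 2 * k.-1)%N by apply: leq_trans ya; rewrite leq_mul2r xy orbT.
have h5 : (x * a2 * (1 + x + z + a2) <= 2 * k.-1 * (1 + x + z + a2))%N.
  by rewrite leq_mul2r h4 orbT.
lia.
Qed.

(** The dimension count of a block with y + 1 tangent spaces, after cancellation.  In
  the odd case the bound on k is used directly when k is large, and
  a0 + a1 <= 2 a2 otherwise. *)
Lemma block_budget : (y * (a0 + a1 - 2) + 2 * k.-1 <= 2 * (a0 * a1))%N.
Proof.
move: kD yb; set K := k.-1 => HK Hy.
have [e0|e0] := eqVneq e 0%N.
  have h1 : (y * a2.+1 <= 2 * K)%N by rewrite nE e0; rewrite e0 subn0 -/K in Hy; lia.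
  have h2 : (y * a2.+1 * (a0 + a1) <= 2 * K * (a0 + a1))%N by rewrite leq_mul2r h1 orbT.
  have h3 : (y * (a0 + a1 - 2) <= y * (a0 + a1))%N by rewrite leq_mul2l leq_subr orbT.
  suff : (y * (a0 + a1) + 2 * K < 2 * c)%N by rewrite cE; lia.
  rewrite -(ltn_pmul2r (ltn0Sn a2)); lia.
have e1' : e = 1%N by lia.
have a20 : (0 < a2)%N.
  by rewrite lt0n; apply/eqP => a2z; move: a02 cE; rewrite a2z leqn0 => /eqP ->; lia.
have [K0|K0] := posnP K.
  have b0 : (0 < b)%N by lia.
  have y00 : y = 0%N.
    rewrite e1' subn1 -/K K0 in Hy; move: Hy; rewrite leqn0 muln_eq0.
    by move=> /orP[/eqP//|/eqP bz]; rewrite bz in b0.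
  by rewrite y00 K0.
have h1 : (y * a2 <= 2 * K.-1)%N.
  have a2b : (a2 = b * 2)%N by lia.
  by rewrite a2b; rewrite e1' subn1 -/K in Hy; lia.
have [a00 a10] : (0 < a0)%N /\ (0 < a1)%N.
  by apply/andP; rewrite -muln_gt0 cE; lia.
rewrite -(leq_pmul2r a20) cE.
have [d dE] : exists d, (a0 + a1 = d + 2)%N by exists (a0 + a1 - 2)%N; lia.
have [K' KE] : exists K', K = K'.+1 by exists K.-1; lia.
have -> : (a0 + a1 - 2 = d)%N by lia.
rewrite KE /= in HK h1 *.
have h2 : (y * a2 * d <= 2 * K' * d)%N by rewrite leq_mul2r h1 orbT.
have HK2 : (K'.+1 * (d + 3 + a2) < c * a2.+1)%N.
  by apply: leq_ltn_trans HK; rewrite leq_mul2l; apply/orP; right; lia.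
suff : (K' * d + K'.+1 * a2 <= c * a2 + a2 * a2)%N by lia.
have [h3|h3] := leqP c (3 * K'.+1); first by lia.
have h4 : (K'.+1 * (d + a2) <= K'.+1 * (3 * a2))%N by rewrite leq_mul2l; apply/orP; right; lia.
have h5 : (3 * K'.+1 * a2 <= c * a2)%N by rewrite leq_mul2r (ltnW h3) orbT.
lia.
Qed.

(** The right-hand side is the number of double points; half of s is rounded down,
  which costs at most a0 + a1 + 2 - 2 s dimensions. *)
Lemma pencil_capacity s : (s <= y.+1)%N ->
  [/\ (s <= a0.+1)%N, (s <= a1.+1)%N &
  (k - s <= (a0.+1 - s) * (a1.+1 - s) + (s./2 * (a1.+1 - s) + (a0.+1 - s) * s./2))%N].
Proof.
move=> sy; have y0 := block_size_lt cE a02 a12 kD.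
have y1 : (y < a1)%N.
  apply: (@block_size_lt a1 a0); rewrite ?[(a1 * a0)%N]mulnC //.
  by move: kD; rewrite [(1 + a1 + a0)%N]addnAC.
split; try lia.
have budget := block_budget.
have [s0|s0] := posnP s.
  rewrite s0 !subn0 /= mul0n muln0 !addn0.
  have : (k.-1 < c)%N.
    rewrite -(ltn_pmul2r (ltn0Sn a2)); apply: leq_ltn_trans kD.
    by rewrite leq_mul2l; apply/orP; right; lia.
  lia.
have [X XE] : exists X, (a0.+1 = s + X)%N by exists (a0.+1 - s)%N; lia.
have [Y YE] : exists Y, (a1.+1 = s + Y)%N by exists (a1.+1 - s)%N; lia.
have -> : (a0.+1 - s = X)%N by lia.
have -> : (a1.+1 - s = Y)%N by lia.
have half : (s.-1 <= 2 * s./2)%N by lia.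
have h1 : (s.-1 * (X + Y) <= 2 * s./2 * (X + Y))%N by rewrite leq_mul2r half orbT.
have h2 : (s.-1 * (a0 + a1 - 2) <= y * (a0 + a1 - 2))%N.
  by rewrite leq_mul2r; apply/orP; right; lia.
have [s' sE] : exists s', s = s'.+1 by exists s.-1; lia.
have [d dE] : exists d, (a0 + a1 = d + 2)%N by exists (a0 + a1 - 2)%N; lia.
have a0E : (a0 = s' + X)%N by lia.
have a1E : (a1 = s' + Y)%N by lia.
have d' : (a0 + a1 - 2 = d)%N by lia.
rewrite d' sE /= in budget h1 h2; rewrite sE.
have sd : (s' * (d + 2) = s' * (s' + X + (s' + Y)))%N by rewrite -dE a0E a1E.
have a01 : (a0 * a1 = (s' + X) * (s' + Y))%N by rewrite a0E a1E.
set h := _./2 in h1 *; set K := k.-1 in budget *.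
have -> : (k - s'.+1 = K - s')%N by rewrite /K -[k in LHS]subn0 -subnDA add0n -subn1 -subnDA.
lia.
Qed.

End Arithmetic.

(** * Independent tangent spaces for the whole range of k *)

Lemma minn1_block B b e n : (n.+1 = b * 2 + e)%N -> (B < b)%N -> minn 1 (n - B * 2) = 1%N.
Proof. by lia. Qed.

Section Induction.
Variables (C : numFieldType) (a : nat -> nat) (c : nat).
Hypotheses (cE : (a 0 * a 1 = c + a 2)%N) (c0 : (0 < c)%N).
Hypotheses (a02 : (a 0 <= a 2)%N) (a12 : (a 1 <= a 2)%N).

(** Two-dimensional blocks; when the third dimension is odd, the point 0 goes to the
  remaining one-dimensional block, and the others are distributed evenly. *)
Lemma nondefective3 k : (k.-1 * (1 + a 0 + a 1 + a 2) < c * (a 2).+1)%N ->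
  nondefective C 3 a k.
Proof.
move=> kD; pose b := ((a 2).+1 %/ 2)%N; pose e := ((a 2).+1 %% 2)%N.
have nE : (a 2).+1 = (b * 2 + e)%N := divn_eq _ _.
have e1 : (e <= 1)%N by rewrite -ltnS ltn_pmod.
have a20 : (0 < a 2)%N.
  by rewrite lt0n; apply/eqP => a2z; move: a02 cE; rewrite a2z leqn0 => /eqP ->; lia.
have b0 : (0 < b)%N by lia.
pose beta (p : 'I_k) := if (p < e)%N then b else ((p - e) %% b)%N.
have a2E : (a 2 %/ 2 = b + e - 1)%N by lia.
have beta_lt (p : 'I_k) : (e <= p)%N -> (beta p < b)%N.
  by rewrite /beta; case: (ltnP p e) => // _ _; rewrite ltn_pmod.
apply: (@direct_split_generic _ _ 2 2 a beta) => //.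
  move=> p; rewrite a2E; have [pe|ep] := ltnP p e; last by have := beta_lt p ep; lia.
  by rewrite /beta pe; lia.
move=> B HB; pose S := [pred p | beta p == B].
have [Bb|bB] := ltnP B b.
  have y_b : ((k - e).-1 %/ b * b <= (k - e).-1)%N by apply: leq_trunc_div.
  have cardS : (#|S| <= ((k - e).-1 %/ b).+1)%N.
    apply: leq_trans (card_residue_le k e B b0).
    apply: subset_leq_card; apply/fintype.subsetP => p; rewrite !inE /beta.
    by case: ltnP => [_ /eqP E|_ ->//]; rewrite E ltnn in Bb.
  have [S0 S1 count] := pencil_capacity cE c0 a02 a12 kD nE e1 y_b cardS.
  have dims2 : block_dims 2 2 a B 2 = 1%N by apply: minn1_block nE Bb.
  have [|piv [v [piv_a Hv]]] := direct_pencil_block C dims2 S0 S1.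
    rewrite !card_sum !card_prod !card_ord; apply: leq_trans count.
    have E : (#|[predC S]| + #|S| = k)%N by rewrite addnC cardC card_ord.
    by rewrite -(leq_add2r #|S|) E subnK // -[X in (_ <= X)%N](card_ord k) max_card.
  exists piv, v; split; first by case=> p pk [|[|]] // _; apply: (piv_a (Ordinal pk)).
  exact: Hv.
have BE : B = b by rewrite a2E in HB; lia.
have e1E : e = 1%N by rewrite a2E in HB; lia.
have cardS : (#|S| <= 1)%N.
  apply/card_le1P => p; rewrite inE => /eqP pB p'; rewrite !inE.
  have zero (x : 'I_k) : beta x == B -> x = 0%N :> nat.
    rewrite BE; have := beta_lt x; case: (posnP x) => // x0.
    by rewrite e1E => /(_ x0) + /eqP E; rewrite E ltnn.
  apply/eqP/eqP => [/eqP H|->]; last by [].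
  by apply: val_inj; rewrite /= (zero p') // (zero p) ?pB.
have [|piv [v [piv_a Hv]]] := direct_tangents_points (nondefective1 C 2 a) cardS.
  rewrite card_ord !big_ord_recr !big_ord0 /=.
  have K1 : (k.-1 < c)%N.
    rewrite -(ltn_pmul2r (ltn0Sn (a 2))); apply: leq_ltn_trans kD.
    by rewrite leq_mul2l; apply/orP; right; lia.
  move: cardS; case: #|S| => [|[|//]] _; lia.
exists piv, (fun p i l => if i == 2 then 1 else v p i l); split=> //.
apply: direct_lift Hv => [[|[|]] //|].
by rewrite /block_dims /= BE; lia.
Qed.

(** With y = (k - 1) / n_(q+1), a block of the step to q + 1 factors has at most y + 1
  tangent spaces, and y D_q + (k - 1) < c M_q + y.  This keeps y + 1 within the
  bound for q factors and, as D_q <= D_3 M_q, leaves room for all the other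
  points. *)
Lemma nondefective_bound r k :
  (k.-1 * (1 + \sum_(i < r + 3) a i) < c * \prod_(i < r + 3 | (2 <= i)%N) (a i).+1)%N ->
  nondefective C (r + 3) a k.
Proof.
pose D r := (1 + \sum_(i < r + 3) a i)%N.
pose M r := (\prod_(i < r + 3 | (2 <= i)%N) (a i).+1)%N.
have D0 : D 0%N = (1 + a 0 + a 1 + a 2)%N.
  by rewrite /D /= !big_ord_recr big_ord0 /=; lia.
have M0 : M 0%N = (a 2).+1.
  by rewrite /M /= big_mkcond !big_ord_recr big_ord0 /= !mul1n.
have DS s : D s.+1 = (D s + a (s + 3))%N.
  by rewrite /D addSn big_ord_recr /= addnA.
have MS s : M s.+1 = (M s * (a (s + 3)).+1)%N.
  rewrite /M addSn big_mkcond big_ord_recr -big_mkcond /= ifT //; lia.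
have M_gt0 s : (0 < M s)%N by apply: prodn_cond_gt0.
have DM s : (D s <= D 0 * M s)%N.
  elim: s => [|s IHs]; first by rewrite leq_pmulr.
  rewrite DS MS mulnA mulnS; apply: leq_add => //.
  by rewrite leq_pmull // muln_gt0 M_gt0.
have N_E s : (\prod_(i < s + 3) (a i).+1 = (c + D 0) * M s)%N.
  elim: s => [|s IHs].
    rewrite D0 M0 /= !big_ord_recr big_ord0 /=.
    nia.
  by rewrite addSn big_ord_recr /= IHs MS mulnA.
rewrite -/(D r) -/(M r); elim: r k => [|r IHr] k Hk.
  by apply: nondefective3; rewrite -D0 -M0.
rewrite addSn; set n := (a (r + 3)).+1; set y := (k.-1 %/ n)%N.
have yn : (y * n <= k.-1)%N by apply: leq_trunc_div.
have DSn : (D r.+1 = (D r).-1 + n)%N by rewrite DS /n /D; lia.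
rewrite MS -/n in Hk.
have hy : (y * (D r).-1 + k.-1 < c * M r)%N.
  rewrite -(ltn_pmul2r (ltn0Sn (a (r + 3)))) -/n.
  apply: leq_ltn_trans (_ : (k.-1 * D r.+1 < _)%N); last by rewrite -mulnA.
  rewrite DSn mulnDl mulnDr leq_add2r mulnAC leq_mul2r yn orbT //.
apply: nondefective_step; rewrite -/n -/y.
  apply: IHr; rewrite -/(D r) -/(M r) /=; apply: leq_ltn_trans hy.
  have -> : D r = (D r).-1.+1 by rewrite /D.
  by rewrite mulnS addnC leq_add2l (leq_trans _ yn) // leq_pmulr.
rewrite N_E; have := DM r; have : \sum_(i < r + 3) a i = (D r).-1 by rewrite /D.
move=> ->; rewrite mulnDl mulSn; lia.
Qed.

End Induction.

(** * Chains in the secant variety: the upper bound *)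

Section SecantDimension.
Variables (C : numFieldType) (q : nat) (a : 'I_q -> nat) (k : nat).
Local Open Scope classical_set_scope.

(** Dimensions and multi-indices as functions on natural numbers, as in [direct]. *)
Definition nat_dims (i : nat) : nat := if insub i is Some o then a o else 0%N.

Lemma nat_dimsE (i : 'I_q) : nat_dims i = a i.
Proof. by rewrite /nat_dims valK. Qed.

Definition coord (j : 'I_#|multi_index a|) (i : nat) : nat :=
  if insub i is Some o then (enum_val j : multi_index a) o else 0%N.

Lemma coordE j (i : 'I_q) : coord j i = (enum_val j : multi_index a) i.
Proof. by rewrite /coord valK. Qed.

Lemma coord_surj J : in_box q nat_dims J ->
  exists j, forall i, (i < q)%N -> coord j i = J i.
Proof.
move=> HJ; exists (enum_rank ([ffun i : 'I_q => inord (J i)] : multi_index a)) => i iq.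
rewrite -[ i ]/(val (Ordinal iq)) coordE enum_rankK ffunE inordK // ltnS.
by rewrite -nat_dimsE HJ.
Qed.

Lemma segre_vector_neq0 (w : forall i : 'I_q, 'rV[C]_(a i).+1) :
  (forall i, w i != 0) -> segre_vector w != 0.
Proof.
move=> w0.
have ex i : exists l, w i 0 l != 0.
  apply/existsP; apply: contraNT (w0 i) => /existsPn H.
  by apply/eqP/rowP => l; rewrite [RHS]mxE; apply/eqP/negPn/H.
pose j : multi_index a := [ffun i => xchoose (ex i)].
apply/eqP => /rowP/(_ (enum_rank j)); rewrite !mxE enum_rankK => /eqP.
apply/negP; apply/prodf_neq0 => i _; rewrite ffunE.
exact: (xchooseP (ex i)).
Qed.

(** If a component of w vanishes, then so does the tensor, and any point of X will do. *)
Lemma segre_vector_in (w : forall i : 'I_q, 'rV[C]_(a i).+1) :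
  exists2 L, segre_variety C a L & segre_vector w \in val L.
Proof.
have [/forallP w0|/forallPn[i wi]] := boolP [forall i, w i != 0].
  exists (proj_point (segre_vector_neq0 w0)); last exact: memv_line.
  by exists w.
have e0 (i' : 'I_q) : delta_mx 0 ord0 != 0 :> 'rV[C]_(a i').+1.
  by apply/eqP => /matrixP/(_ 0 ord0); rewrite !mxE !eqxx => /eqP; rewrite oner_eq0.
exists (proj_point (segre_vector_neq0 e0)); first by exists (fun i' => delta_mx 0 ord0).
suff -> : segre_vector w = 0 by apply: mem0v.
apply/rowP => j; rewrite !mxE (bigD1 i) //=.
by move: wi; rewrite negbK => /eqP ->; rewrite mxE mul0r.
Qed.

Section Upper.

Definition chart_param : finType := ('I_k * option {i : 'I_q & 'I_(a i)})%type.

Lemma card_chart_param : #|chart_param| = (k * (1 + \sum_(i < q) a i))%N.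
Proof.
rewrite card_prod card_ord card_option card_tagged sumnE big_map big_enum /=.
by congr (_ * _.+1)%N; apply: eq_bigr => i _; rewrite card_ord.
Qed.

(** The open chart of the k-fold sum in which every component of every point has first
  coordinate 1; the parameter indexed by None is the coefficient of the point. *)
Definition chart_coord (p : 'I_k) (i : 'I_q) (l : 'I_(a i).+1) :
  {mpoly C[#|chart_param|]} :=
  if unlift ord0 l is Some l' then 'X_(enum_rank (p, Some (Tagged (fun i => 'I_(a i)) l')))
  else 1.

Definition chart (j : 'I_#|multi_index a|) : {mpoly C[#|chart_param|]} :=
  \sum_(p < k) 'X_(enum_rank (p, None)) *
    \prod_(i < q) chart_coord p ((enum_val j : multi_index a) i).

(** Every point of the secant variety spanned by points of X is the value at t = 0 of a
  curve that lies in the chart for almost all t: add t times the first unit vector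
  to every component. *)
Lemma chart_dense (P : {mpoly C[#|multi_index a|]}) :
  P \mPo [tuple chart j | j < #|multi_index a|] = 0 ->
  vanishing (secant_variety (segre_variety C a) k) P.
Proof.
move=> P0; apply/vanishing_closure => L [x [xX Lx]] w wL.
have {Lx wL} /memv_sumP[ws ws_in ->] := subvP Lx w wL.
have ex (p : 'I_k) : exists cv : C * (forall i : 'I_q, 'rV[C]_(a i).+1),
    ws p = cv.1 *: segre_vector cv.2.
  have [v [_ xE]] := xX p; have := ws_in p isT; rewrite xE => /vlineP[c ->].
  by exists (c, v).
have [cv cvE] := choice ex.
pose u p i l : {poly C} := ((cv p).2 i 0 l)%:P + (l == ord0)%:R *: 'X.
pose W (j : 'I_#|multi_index a|) : {poly C} :=
  \sum_(p < k) ((cv p).1)%:P * \prod_(i < q) u p i ((enum_val j : multi_index a) i).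
pose g : {poly C} := \prod_(p < k) \prod_(i < q) u p i ord0.
have PW0 : along P W = 0.
  apply: (@poly_eq0_off _ g).
    apply/prodf_neq0 => p _; apply/prodf_neq0 => i _.
    by rewrite /u eqxx scale1r addrC -size_poly_eq0 size_XaddC.
  move=> t gt; have ut p i : (u p i ord0).[t] != 0.
    apply: contraNneq gt => u0; rewrite /g horner_prod (bigD1 p) //=.
    by rewrite horner_prod (bigD1 i) //= u0 !mul0r.
  pose s (y : 'I_#|chart_param|) : C := match enum_val y with
    | (p, None) => (cv p).1 * \prod_(i < q) (u p i ord0).[t]
    | (p, Some il) => (u p (tag il) (lift ord0 (tagged il))).[t] / (u p (tag il) ord0).[t]
    end.
  have chartE j : (chart j).@[s] = (W j).[t].
    rewrite /chart /W raddf_sum horner_sum; apply: eq_bigr => p _.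
    rewrite /= mevalM mevalXU {1}/s enum_rankK hornerM hornerC -mulrA; congr (_ * _).
    rewrite rmorph_prod horner_prod -big_split /=; apply: eq_bigr => i _.
    rewrite /chart_coord; case: unliftP => [l'|] ->; last by rewrite meval1 mulr1.
    by rewrite mevalXU /s enum_rankK /= mulrC divfK.
  rewrite alongE -[RHS](meval0 s) -P0 comp_mpoly_meval.
  by apply: meval_eq => j; rewrite tnth_mktuple chartE.
have := congr1 (fun r => r.[0]) PW0; rewrite horner0 alongE => <-.
apply: meval_eq => j; rewrite summxE horner_sum; apply: eq_bigr => p _.
rewrite cvE !mxE hornerM hornerC; congr (_ * _); rewrite horner_prod.
by apply: eq_bigr => i _; rewrite /u hornerD hornerC hornerZ hornerX mulr0 addr0.
Qed.

Lemma secant_chain_le e c :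
  irreducible_chain (secant_variety (segre_variety C a) k) e c ->
  (e < k * (1 + \sum_(i < q) a i))%N.
Proof. by rewrite -card_chart_param; apply: chain_bound chart_dense _ _. Qed.

End Upper.
End SecantDimension.

(** * Chains in the secant variety: the construction *)

Section Expansion.
Variable C : numFieldType.
Implicit Types (v tau : nat -> nat -> C) (J : nat -> nat).

Lemma segre_coord_expand q v tau J : exists Q : {poly C},
  \prod_(i < q) ((v i (J i))%:P + 'X * (tau i (J i))%:P) =
  (segre_coord q v J)%:P + 'X * (tangent_coord q 0 v tau J)%:P + 'X^2 * Q.
Proof.
elim: q => [|q [Q IHq]].
  exists 0; rewrite /segre_coord /tangent_coord !big_ord0 mul0r addr0 polyC0 polyC1.
  by rewrite !mulr0 !addr0.
exists ((tangent_coord q 0 v tau J * tau q (J q))%:P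
  + Q * ((v q (J q))%:P + 'X * (tau q (J q))%:P)).
rewrite big_ord_recr /= IHq tangent_coordS segre_coordS !(polyCD, polyCM); ring.
Qed.

Lemma tangent_coord_sum (I : finType) q (x : I -> C) v (tau : I -> nat -> nat -> C) J :
  tangent_coord q 0 v (fun i l => \sum_r x r * tau r i l) J
  = \sum_r x r * tangent_coord q 0 v (tau r) J.
Proof.
rewrite /tangent_coord mul0r add0r.
under eq_bigr do rewrite mulr_suml.
rewrite exchange_big /=; apply: eq_bigr => r _.
by rewrite add0r mulr_sumr; apply: eq_bigr => i _; rewrite mulrA.
Qed.

End Expansion.

Section SecantChain.
Variables (C : numFieldType) (q : nat) (a : 'I_q -> nat) (k : nat).
Hypotheses (q0 : (0 < q)%N) (k0 : (0 < k)%N).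
Variables (piv : 'I_k -> nat -> nat) (v : 'I_k -> nat -> nat -> C).
Hypothesis piv_le : forall p i, (i < q)%N -> (piv p i <= nat_dims a i)%N.

Let dims := nat_dims a.
Let D (p : 'I_k) (i l : nat) := l != piv p i.
Hypothesis v_direct : direct q dims D v.

Let p0 : 'I_k := Ordinal k0.

(** All the tangent directions except the scaling of the first point, whose role is played
  by the sum of all the points. *)
Definition chain_dir : pred (direction 'I_k q dims) :=
  [pred x | allowed q dims D x && (x != inl p0)].

Lemma card_chain_dir : #|chain_dir| = (k * (1 + \sum_(i < q) a i) - 1)%N.
Proof.
have : #|allowed q dims D| = (k * (1 + \sum_(i < q) a i))%N.
  rewrite card_allowed /count_dirs card_ord (eq_bigr (fun=> \sum_(i < q) a i)%N).
    by rewrite sum_nat_const card_ord mulnDr muln1.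
  move=> p _; apply: eq_bigr => i _; rewrite /D sum_neq_le; first exact: nat_dimsE.
  exact: piv_le.
rewrite (cardD1x (j := inl p0)) // => <-; rewrite addnC addnK.
by apply: eq_card => x; rewrite !inE andbC.
Qed.

(** Moving along a direction means adding a unit vector to one factor of one
  point, or rescaling the first factor of that point. *)
Definition dir_tau (x : direction 'I_k q dims) (p : 'I_k) (i l : nat) : C :=
  match x with
  | inl p' => ((p == p') && (i == 0%N))%:R * v p' i l
  | inr (p', (i', l')) => [&& p == p', i == i' & l == l']%:R
  end.

Lemma sum_dir_tau x J :
  \sum_p tangent_coord q 0 (v p) (dir_tau x p) J = direction_vector v x J.
Proof.
have only p : (forall p' i, p' != p -> dir_tau x p' i (J i) = 0) ->
    \sum_p' tangent_coord q 0 (v p') (dir_tau x p') J =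
    \sum_(i < q) dir_tau x p i (J i) * segre_cofactor q (v p) i J.
  move=> Hp; rewrite (bigD1 p) //= big1 ?addr0 => [|p' p'p]; last first.
    by rewrite tangent_coord_notau ?mul0r // => i _; apply: Hp.
  by rewrite /tangent_coord mul0r add0r.
case: x only => [p|[p [i l]]] only; rewrite (only p) /=;
  try by move=> p' i' /negPf ->; rewrite /= ?mul0r.
  rewrite (bigD1 (Ordinal q0)) //= !eqxx mul1r big1 ?addr0 => [|i i0]; last first.
    by rewrite (_ : (i == 0 :> nat)%N = false) ?mul0r //; apply/negbTE.
  by rewrite /segre_cofactor /segre_coord [RHS](bigD1 (Ordinal q0)).
rewrite (bigD1 i) //= !eqxx /= [X in _ + X]big1 ?addr0 // => i' i'i.
by rewrite (_ : (i' == i :> nat) = false) ?mul0r //; apply/negbTE.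
Qed.

Local Notation d := #|chain_dir|.
Local Notation N := #|multi_index a|.

(** The base point of the chain, which is the sum of the chosen points, followed by the
  derivatives of the parametrization [chain_param]. *)
Definition chain_mx : 'M[C]_(d.+1, N) := \matrix_(r, j)
  if unlift ord0 r is Some r' then direction_vector v (enum_val r') (coord j)
  else \sum_p direction_vector v (inl p : direction 'I_k q dims) (coord j).

Lemma direction_vector_eq x J J' : (forall i, (i < q)%N -> J i = J' i) ->
  direction_vector v x J = direction_vector v (x : direction 'I_k q dims) J'.
Proof.
move=> JJ'; case: x => [p|[p [i l]]] /=.
  by apply: eq_segre_coord => i iq; rewrite JJ'.
by rewrite JJ' //; congr (_ * _); apply: eq_bigr => i' _; rewrite JJ'.
Qed.

Lemma chain_mx_free : row_free chain_mx.
Proof.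
apply: row_freePn_vec => u uK.
pose c x : C := if x == inl p0 then u 0 ord0 else
  (if x is inl _ then u 0 ord0 else 0) +
  \sum_(r | enum_val r == x) u 0 (lift ord0 r).
have cr r : \sum_(r' : 'I_d | enum_val r' == enum_val r) u 0 (lift ord0 r') = u 0 (lift ord0 r).
  by rewrite (eq_bigl (pred1 r)) ?big_pred1_eq // => r'; rewrite (inj_eq enum_val_inj).
have crN x : ~~ chain_dir x -> \sum_(r : 'I_d | enum_val r == x) u 0 (lift ord0 r) = 0.
  by move=> xN; apply: big_pred0 => r; apply: contraNF xN => /eqP <-; apply: (enum_valP r).
have c0 x : c x = 0.
  have /direct_row_free/(indepP _ (fun x (J : box q dims) =>
    direction_vector v x (box_fun J))) H := v_direct.
  apply: (H c) => {x} [x xN|J].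
    have x0 : x != inl p0 by apply: contraNneq xN => ->.
    rewrite /c (negPf x0) crN ?addr0; last by rewrite /chain_dir /= (negPf xN).
    by case: x xN {x0}.
  have [j jJ] := coord_surj (@box_fun_in_box _ _ J).
  transitivity ((u *m chain_mx) 0 j); last by rewrite uK mxE.
  rewrite mxE big_ord_recl mxE unlift_none mulr_sumr.
  rewrite (eq_bigr (fun x => (if x is inl _ then u 0 ord0 else 0) * direction_vector v x (coord j)
    + (\sum_(r | enum_val r == x) u 0 (lift ord0 r)) * direction_vector v x (coord j))).
    rewrite big_split /=; congr (_ + _).
      rewrite big_sumType /= [X in _ + X]big1 ?addr0 // => y _; exact: mul0r.
    under eq_bigr do rewrite mulr_suml.
    rewrite (exchange_big_dep predT) //=; apply: eq_bigr => r _.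
    by rewrite (big_pred1 (enum_val r)) ?mxE ?liftK // => x; rewrite eq_sym.
  move=> x _; rewrite -mulrDl (direction_vector_eq _ (J' := coord j)); last by move=> i /jJ.
  congr (_ * _); rewrite /c; case: eqP => [->|//].
  by rewrite crN ?addr0 // /chain_dir /= eqxx.
apply/rowP => r; rewrite [RHS]mxE; case: (unliftP ord0 r) => [r'|] ->.
  have /andP[_ rN] := enum_valP r'; have := c0 (enum_val r').
  rewrite /c (negPf rN) cr; case: (enum_val r') => [p|y]; last by rewrite add0r.
  have := c0 (inl p0); rewrite /c eqxx => ->; by rewrite add0r.
by have := c0 (inl p0); rewrite /c eqxx.
Qed.

Definition chain_param (j : 'I_N) : {mpoly C[d]} :=
  \sum_p \prod_(i < q) ((v p i (coord j i))%:MP +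
    \sum_(r < d) (dir_tau (enum_val r) p i (coord j i)) *: 'X_r).

Lemma chain_param_expand (x : 'I_d -> C) j : exists Q,
  along (chain_param j) (fun r => 'X * (x r)%:P) =
  (chain_mx 0 j)%:P + 'X * (\sum_r x r * chain_mx (lift ord0 r) j)%:P + 'X^2 * Q.
Proof.
pose tau p i l := \sum_r x r * dir_tau (enum_val r) p i l.
have /choice[Q QE] := fun p => segre_coord_expand q (v p) (tau p) (coord j).
exists (\sum_p Q p).
transitivity (\sum_p \prod_(i < q) ((v p i (coord j i))%:P + 'X * (tau p i (coord j i))%:P)).
  apply/eqP; rewrite -subr_eq0; apply/eqP.
  apply: (@poly_eq0_off _ 1); first exact: oner_neq0.
  move=> t _; rewrite hornerD hornerN alongE raddf_sum horner_sum.
  apply/eqP; rewrite subr_eq0; apply/eqP.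
  apply: eq_bigr => p _; rewrite /= rmorph_prod horner_prod; apply: eq_bigr => i _.
  rewrite /= mevalD mevalC raddf_sum !hornerE /tau mulr_sumr; congr (_ + _).
  apply: eq_bigr => r _; rewrite /= mevalZ mevalXU hornerM hornerX hornerC.
  by rewrite mulrC mulrA.
under eq_bigr do rewrite QE.
rewrite !big_split /= -!mulr_sumr -!rmorph_sum /=; congr (_ %:P + 'X * _ %:P + _).
  by rewrite mxE unlift_none.
under eq_bigr do rewrite tangent_coord_sum.
rewrite exchange_big /=; apply: eq_bigr => r _; rewrite -mulr_sumr sum_dir_tau.
by rewrite mxE liftK.
Qed.

Local Open Scope classical_set_scope.

Lemma param_image_secant : zariski_closure (param_image chain_param d)
  `<=` secant_variety (segre_variety C a) k.
Proof.
apply: closure_mono => L [t [_ LE]].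
pose w p (i : 'I_q) : 'rV[C]_(a i).+1 :=
  \row_l (v p i l + \sum_r dir_tau (enum_val r) p i l * t r).
have /choice[x xP] : forall p, exists L', segre_variety C a L' /\ segre_vector (w p) \in val L'.
  by move=> p; have [L' ? ?] := segre_vector_in (w p); exists L'.
exists x; split; first by move=> p; have [] := xP p.
rewrite LE -memvE.
have -> : param_point chain_param t = \sum_p segre_vector (w p).
  apply/rowP => j; rewrite summxE mxE raddf_sum; apply: eq_bigr => p _.
  rewrite /= rmorph_prod mxE; apply: eq_bigr => i _.
  rewrite /= mevalD mevalC raddf_sum !mxE -coordE; congr (_ + _).
  by apply: eq_bigr => r _; rewrite /= mevalZ mevalXU.
by apply: memv_sumr => p _; have [] := xP p.
Qed.

Lemma secant_chain : exists c,
  irreducible_chain (secant_variety (segre_variety C a) k)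
    (k * (1 + \sum_(i < q) a i) - 1)%N c.
Proof.
rewrite -card_chain_dir.
have [c [cP clt]] := param_chain chain_mx_free chain_param_expand.
exists c; split=> // i id; have [ci ii cs] := cP i id; split=> //.
exact: subset_trans cs param_image_secant.
Qed.

End SecantChain.

(** The upper bound holds for all k; the independence of the tangent spaces serves to
  build the chain. *)
Theorem secant_dimension (C : numFieldType) q (a : 'I_q -> nat) k :
  (0 < q)%N -> (0 < k)%N -> nondefective C q (nat_dims a) k ->
  has_dimension (secant_variety (segre_variety C a) k) (k * (1 + \sum_(i < q) a i) - 1)%N.
Proof.
move=> q0 k0 [piv [v [piv_le Hv]]]; split; first exact: secant_chain Hv.
by move=> e c /secant_chain_le; lia.
Qed.

(** * The dimension of the secant variety *)

Theorem corollary7p3 (R : realType) (q : nat) (a : 'I_q -> nat) (k : nat)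
  (hq : (3 <= q)%N)
  (ha : forall i j : 'I_q, (i < 2)%N -> j = 2%N :> nat -> (a i <= a j)%N)
  (hk0 : (0 < k)%N)
  (hk : (k%:R <= ((\prod_(i < q) (a i + 1))%N%:R
                  - ((\sum_(i < q | (i < 3)%N) a i + 1)
                     * \prod_(i < q | (2 <= i)%N) (a i + 1))%N%:R)
                 / (1 + \sum_(i < q) a i)%N%:R :> rat)%R) :
  has_dimension (secant_variety (segre_variety R[i] a) k)
                (k * (1 + \sum_(i < q) a i) - 1)%N.
Proof.
apply: (@secant_dimension R[i] q a k) => //; first by apply: leq_trans hq.
have [r qE] : exists r, q = (r + 3)%N by exists (q - 3)%N; lia.
subst q; set A := nat_dims a.
have AE (i : 'I_(r + 3)) : A i = a i by apply: nat_dimsE.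
have A_le i : (i < 2)%N -> (A i <= A 2)%N.
  move=> i2; have i3 : (i < r + 3)%N by lia.
  have j3 : (2 < r + 3)%N by lia.
  by rewrite (AE (Ordinal i3)) (AE (Ordinal j3)) ha.
pose D := (1 + \sum_(i < r + 3) A i)%N.
pose M := (\prod_(i < r + 3 | (2 <= i)%N) (A i).+1)%N.
have {}hk : (k * D + (A 0 + A 1 + A 2 + 1) * M <= (A 0).+1 * (A 1).+1 * M)%N.
  move: hk; rewrite ler_pdivlMr ?ltr0n // lerBrDr -natrM -natrD ler_nat.
  have -> : (\sum_(i < r + 3) a i = \sum_(i < r + 3) A i)%N by apply: eq_bigr.
  have -> : (\sum_(i < r + 3 | (i < 3)%N) a i = A 0 + A 1 + A 2)%N.
    rewrite (eq_bigr (fun i : 'I_(r + 3) => A i)) //.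
    by rewrite -(big_ord_widen (r + 3) A (leq_addl r 3)) !big_ord_recr big_ord0.
  have -> : (\prod_(i < r + 3 | (2 <= i)%N) (a i + 1) = M)%N.
    by apply: eq_bigr => i _; rewrite AE addn1.
  suff -> : (\prod_(i < r + 3) (a i + 1) = (A 0).+1 * (A 1).+1 * M)%N by [].
  rewrite (eq_bigr (fun i : 'I_(r + 3) => (A i).+1)) => [|i _]; last by rewrite AE addn1.
  rewrite (bigID (fun i : 'I_(r + 3) => (i < 2)%N)) /=; congr (_ * _)%N.
    rewrite -(big_ord_widen (r + 3) (fun i => (A i).+1)); last by lia.
    by rewrite !big_ord_recr big_ord0 /= !mul1n.
  by apply: eq_bigl => i; rewrite -leqNgt.
have M0 : (0 < M)%N by apply: prodn_cond_gt0.
have key : (k * D + A 2 * M <= A 0 * A 1 * M)%N by lia.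
have D0 : (0 < D)%N by [].
have kD0 : (0 < k * D)%N by rewrite muln_gt0 hk0 D0.
have lt2 : (A 2 < A 0 * A 1)%N by rewrite -(ltn_pmul2r M0); lia.
apply: (@nondefective_bound _ _ (A 0 * A 1 - A 2)%N); rewrite ?subnK ?subn_gt0 ?A_le //.
  exact: ltnW.
rewrite -/D -/M mulnBl ltn_subRL; apply: leq_trans key.
have : (k.-1 * D < k * D)%N by rewrite ltn_pmul2r // prednK.
lia.
Qed.
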